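(* For every integer $n\ge 1$, the polynomial $$\prod_{k=1}^{n}\bigl(T_k(d)+(-1)^k z\bigr)^{\binom{2n}{n-k}}$$ divides the Gram determinant $D_n^{(Mb)_1}(d,z,x,y,w)$ of type $(Mb)_1$ in the polynomial ring $\mathbb{Z}[d,x,y,z,w]$.
   Context: Let $Mb$ be the Möbius band and fix $2n$ marked points $x_1,\dots,x_{2n}$ on its boundary circle. A crossingless connection is a collection of $n$ pairwise disjoint embedded arcs in $Mb$ whose endpoints are exactly the $2n$ marked points, with no closed components, considered up to isotopy fixing the boundary. Let $Mb_{n,0}$ be the set of crossingless connections none of whose arcs passes through the crosscap (i.e. every arc is contained in a disk in $Mb$; there are $\binom{2n}{n}$ of them), and let $Mb_{n,1}$ be the set of crossingless connections in which exactly one arc passes through the crosscap (once), i.e. exactly one arc is not contained in a disk (there are $\binom{2n}{n-1}$ of them). Put $(Mb_n)_1=Mb_{n,0}\cup Mb_{n,1}$, a set with $\binom{2n}{n}+\binom{2n}{n-1}$ elements. Bilinear form: for $m_i,m_j\in (Mb_n)_1$, glue the Möbius band carrying $m_i$ to a second Möbius band carrying the mirror image of $m_j$ along their boundaries, identifying marked points with the same labels. The result is a Klein bottle containing a disjoint union of simple closed curves. Every such curve is isotopic to one of five classes: $d$ (null-homotopic curve), $z$ (the separating two-sided curve parallel to the common boundary of the two Möbius bands), $x$ (the one-sided core curve of the first Möbius band, the one carrying $m_i$), $y$ (the one-sided core curve of the second Möbius band, carrying the image of $m_j$), and $w$ (the non-separating two-sided curve passing once through each of the two crosscaps). Define $\langle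 m_i,m_j\rangle=d^{a}x^{b}y^{c}z^{e}w^{h}$, where $a,b,c,e,h$ are the numbers of curves of each class. The Gram matrix of type $(Mb)_1$ is $G_n^{(Mb)_1}=(\langle m_i,m_j\rangle)_{m_i,m_j\in (Mb_n)_1}$ (any fixed ordering of $(Mb_n)_1$, used for rows and columns), and $D_n^{(Mb)_1}=\det G_n^{(Mb)_1}\in\mathbb{Z}[d,x,y,z,w]$. $T_k$ denotes the Chebyshev polynomial of the first kind defined by $T_0(d)=2$, $T_1(d)=d$, $T_{k+1}(d)=d\,T_k(d)-T_{k-1}(d)$. *)

(* Defs.v *)
From HB Require Import structures.
From mathcomp Require Import all_boot all_order all_algebra.
From mathcomp Require Import fingraph.
From mathcomp Require Import mpoly.

Set Implicit Arguments.
Unset Strict Implicit.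
Unset Printing Implicit Defensive.

Import GRing.Theory.
Local Open Scope ring_scope.

(* Combinatorial model of (Mb_n)_1 = Mb_{n,0} u Mb_{n,1}.                   *)
(* The 2n marked points are 'I_(n.*2) = {0,...,2n-1}, in cyclic order on    *)
(* the boundary circle.  Gap g (g : 'I_(n.*2)) is the boundary segment      *)
(* between point g and point g+1 (gap 2n-1 is between 2n-1 and 0).         *)
(* A crossingless connection in (Mb_n)_1 is encoded by                     *)
(*  - a noncrossing perfect matching M (fixed-point-free involution) of     *)
(*    the points, namely the arcs drawn in the disk obtained by shrinking   *)
(*    the crosscap to a point, and                                          *)
(*  - a crosscap datum (b, g) :                                             *)
(*      b = false : no arc passes through the crosscap (Mb_{n,0}); the      *)
(*                  crosscap lies in the face of M containing gap g, and g  *)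
(*                  is the smallest gap of that face (canonical choice);    *)
(*      b = true  : the arc {g, M g}, g < M g, is the (unique) arc passing  *)
(*                  once through the crosscap (Mb_{n,1}).                   *)

Definition pts (n : nat) := 'I_(n.*2).
Definition matching n := {ffun pts n -> pts n}.

Definition is_matching n (M : matching n) : bool :=
  [forall i, (M (M i) == i) && (M i != i)].

Definition noncrossing n (M : matching n) : bool :=
  [forall a : pts n, forall b : pts n,
     ((a < M a)%N && (b < M b)%N) ==>
     ~~ [&& (a < b)%N, (b < M a)%N & (M a < M b)%N]].

Definition same_face n (M : matching n) (g h : pts n) : bool :=
  [forall a : pts n, (a < M a)%N ==>
     (((a <= g)%N && (g < M a)%N) == ((a <= h)%N && (h < M a)%N))].

Definition face_rep n (M : matching n) (g : pts n) : bool :=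
  [forall h : pts n, (h < g)%N ==> ~~ same_face M g h].

Definition conn_data n := (matching n * (bool * pts n))%type.

Definition valid_conn n (c : conn_data n) : bool :=
  let: (M, (b, g)) := c in
  [&& is_matching M, noncrossing M &
      if b then (g < M g)%N else face_rep M g].

Definition Mb1 (n : nat) := {c : conn_data n | valid_conn c}.

Definition Pol := {mpoly int[5]}.
Definition vd : Pol := 'X_(@Ordinal 5 0 isT).
Definition vx : Pol := 'X_(@Ordinal 5 1 isT).
Definition vy : Pol := 'X_(@Ordinal 5 2 isT).
Definition vz : Pol := 'X_(@Ordinal 5 3 isT).
Definition vw : Pol := 'X_(@Ordinal 5 4 isT).

(* Bilinear form.  Gluing the two Moebius bands gives a Klein bottle =      *)
(* sphere (two disks glued along the circle of marked points) with one      *)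
(* crosscap c1 in the first hemisphere and one crosscap c2 in the second.   *)
(* The closed curves are the connected components of the graph on the      *)
(* marked points whose edges are the arcs of M1 and of M2.                  *)
(* A curve S (given by its set of marked points) is classified by:          *)
(*  - through c1 and c2 : w ; through c1 only : x ; through c2 only : y ;   *)
(*  - through neither: S separates the sphere into two disks; it is z if    *)
(*    c1 and c2 lie on different sides, and d otherwise.  The side of a     *)
(*    boundary gap g (or of a point g not on S) is the parity of the number *)
(*    of points of S in [0, g] (S crosses the circle at each of its points).*)
(*    c1 lies on the side of its gap g1 (case Mb_{n,0}) or of the endpoint  *)
(*    g1 of its crosscap arc (case Mb_{n,1}); same for c2.                   *)

Definition side n (S : {set pts n}) (g : pts n) : bool :=
  odd #|[set u in S | (u <= g)%N]|.

Definition curve_class n (c1 c2 : conn_data n) (S : {set pts n}) : Pol :=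
  let: (_, (b1, g1)) := c1 in
  let: (_, (b2, g2)) := c2 in
  let t1 := b1 && (g1 \in S) in
  let t2 := b2 && (g2 \in S) in
  if t1 && t2 then vw
  else if t1 then vx
  else if t2 then vy
  else if side S g1 != side S g2 then vz
  else vd.

Definition glue_rel n (M1 M2 : matching n) : rel (pts n) :=
  fun u v => (M1 u == v) || (M2 u == v).

Definition curves n (M1 M2 : matching n) : {set {set pts n}} :=
  [set [set u | connect (glue_rel M1 M2) v u] | v : pts n].

Definition pairing n (c1 c2 : conn_data n) : Pol :=
  \prod_(S in curves c1.1 c2.1) curve_class c1 c2 S.

Definition Gram n : 'M[Pol]_#|{: Mb1 n}| :=
  \matrix_(i, j) pairing (val (enum_val i)) (val (enum_val j)).

Definition GramDet (n : nat) : Pol := \det (Gram n).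

Fixpoint chebT_aux (R : pzRingType) (t : R) (k : nat) : R * R :=
  match k with
  | 0 => (2%:R, t)
  | k'.+1 => let: (a, b) := chebT_aux t k' in (b, t * b - a)
  end.
Definition chebT (R : pzRingType) (t : R) (k : nat) : R := (chebT_aux t k).1.

(* Main.v *)
Require Import Defs.
From HB Require Import structures.
From mathcomp Require Import all_boot all_order all_algebra all_fingroup.
From mathcomp Require Import mpoly.
From mathcomp Require Import zify ring.

(** Let [N = 2n] and specialise [d = q + 1/q], [z = t + 1/t] with
    [t = (-1)^(k+1) q^k], so that the [k]-th factor [T_k(d) + (-1)^k z] vanishes.
    For two connections avoiding the crosscaps, the pairing is a sum over the
    orientations of the curves, computed by local weights at the [N] points: a
    contractible curve turns once and gets [q] or [1/q], a curve separating the
    crosscaps gets [t] or [1/t].  Hence the Gram matrix restricted to the rows of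
    [Mb_{n,0}] factors through the space of balanced sign sequences, of dimension
    [C(2n,n) = #|Mb_{n,0}|].  For a column in [Mb_{n,1}], pushing the crosscap off
    its arc to either side gives two connections in [Mb_{n,0}] whose pairings add
    up to [(d + z) / y] times the given one, and [d + z != 0].
    At [t = +- q^k], the orientation vectors of all connections are killed by the
    [k]-th divided power of a raising operator of the quantum group of [sl_2],
    which maps balanced sequences onto sequences with [n - k] minus signs.  So the
    Gram matrix has corank at least [C(2n, n-k)], and
    [(z - z_k)^C(2n,n-k)] divides the specialised determinant.  The roots [z_k] are
    distinct, and division by a monic polynomial in [z] lifts the divisibility from
    infinitely many specialisations to the integers. *)

Set Implicit Arguments.
Unset Strict Implicit.
Unset Printing Implicit Defensive.

Import Order.TTheory GRing.Theory Num.Theory.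
Local Open Scope ring_scope.

(** * Ranks and divisibility of determinants *)

(** The vectors [X w] are independent and lie in the kernel of the left factor, whose rank is
    therefore at most [#|PU| - #|PW|]. *)
Lemma rank_factor_le (F : fieldType) (I U W : finType) (PU : {pred U})
    (PW : {pred W}) (G : 'M[F]_#|{: I}|) (L : I -> U -> F) (R : U -> I -> F)
    (X : W -> U -> F) :
  (forall i j, G i j = \sum_(u in PU) L (enum_val i) u * R u (enum_val j)) ->
  (forall i w, w \in PW -> \sum_(u in PU) L i u * X w u = 0) ->
  (forall f : W -> F,
     (forall u, u \in PU -> \sum_(w in PW) f w * X w u = 0) ->
     forall w, w \in PW -> f w = 0) ->
  (#|PU| <= #|I|)%N ->
  (\rank G + #|PW| <= #|I|)%N.
Proof.
move=> GE LX0 Xfree leUI.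
pose ML : 'M[F]_(#|{: I}|, #|PU|) := \matrix_(i, j) L (enum_val i) (enum_val j).
pose MR : 'M[F]_(#|PU|, #|{: I}|) := \matrix_(i, j) R (enum_val i) (enum_val j).
pose MX : 'M[F]_(#|PW|, #|PU|) := \matrix_(i, j) X (enum_val i) (enum_val j).
have GLR : G = ML *m MR.
  apply/matrixP => i j; rewrite GE mxE big_enum_val.
  by apply: eq_bigr => u _; rewrite !mxE.
have LX : ML *m MX^T = 0.
  apply/matrixP => i j; rewrite !mxE -[RHS](LX0 (enum_val i) (enum_val j)) ?enum_valP //.
  by rewrite [RHS]big_enum_val; apply: eq_bigr => u _; rewrite !mxE.
have rX : \rank MX = #|PW|.
  apply/eqP; rewrite -/(row_free MX) -kermx_eq0; apply/eqP/row_matrixP => i.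
  rewrite row0; set v := row i _.
  have vX : v *m MX = 0 by rewrite -row_mul mulmx_ker row0.
  have [w0 w0P | PW0] := pickP PW; last first.
    apply/matrixP => a b; exfalso.
    by have := enum_valP b; rewrite unfold_in PW0.
  have h := Xfree (fun w => v 0 (enum_rank_in w0P w)) _ _ (enum_valP _).
  apply/rowP => j; rewrite [RHS]mxE -(h _ j) ?enum_valK_in // => u Pu.
  have := congr1 (fun B : 'rV__ => B 0 (enum_rank_in Pu u)) vX.
  rewrite mxE [RHS]mxE => vX0; rewrite -[RHS]vX0 [LHS]big_enum_val.
  by apply: eq_bigr => w _; rewrite enum_valK_in [MX _ _]mxE enum_rankK_in.
have := mulmx0_rank_max LX; rewrite mxrank_tr rX => h.
apply: leq_trans leUI; apply: leq_trans h; rewrite leq_add2r GLR.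
exact: mxrankM_maxl.
Qed.

(** A constant change of basis makes all rows beyond the rank vanish at [a]; each of these rows
    contributes a factor ['X - a%:P]. *)
Lemma det_dvdp_rank (F : fieldType) (n m : nat) (G : 'M[{poly F}]_n) (a : F) :
  (\rank (map_mx (horner_eval a) G) + m <= n)%N ->
  ('X - a%:P) ^+ m %| \det G.
Proof.
set G0 := map_mx _ G => hr.
(* [invmx Q] cancels the left factor of the rank factorisation of [G0], so that the rows of index at
   least [r] of the product vanish at [a]. *)
pose Q := col_ebase G0; pose r : nat := \rank G0.
have Qu : Q \in unitmx by apply: col_ebase_unit.
pose H := map_mx polyC (invmx Q) *m G.
have H0 (i j : 'I_n) : (r <= i)%N -> ('X - a%:P) %| H i j.
  move=> ri; rewrite dvdp_XsubCl rootE.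
  have -> : (H i j).[a] = (map_mx (horner_eval a) H) i j by rewrite [RHS]mxE.
  rewrite map_mxM -map_mx_comp /=.
  have -> : map_mx (horner_eval a \o polyC) (invmx Q) = invmx Q.
    by apply/matrixP => u v; rewrite mxE /= /horner_eval hornerC.
  rewrite -/G0 -(mulmx_ebase G0) -/Q -mulmxA mulKmx // mxE big1 // => u _.
  by rewrite !mxE [(i < \rank _)%N]ltnNge ri andbF mul0r.
pose H' := \matrix_(i, j) (if (r <= i)%N then H i j %/ ('X - a%:P) else H i j) : 'M_n.
pose D := \row_i (if (r <= i)%N then 'X - a%:P else 1) : 'rV[{poly F}]_n.
have HD : H = diag_mx D *m H'.
  apply/matrixP => i j; rewrite mul_diag_mx [RHS]mxE [D _ _]mxE [H' _ _]mxE; case: ifP => ri; last by rewrite mul1r.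
  by rewrite mulrC divpK // H0.
have dG : \det G = (\det Q)%:P * \det H.
  rewrite det_mulmx det_map_mx mulrA -polyCM -det_mulmx mulmxV // det1.
  by rewrite mul1r.
rewrite dG HD det_mulmx det_diag; apply: dvdp_mull; apply: dvdp_mulr.
have -> : \prod_i D 0 i = ('X - a%:P) ^+ (n - r).
  rewrite (eq_bigr (fun i : 'I_n => if (r <= i)%N then 'X - a%:P else 1)); last by move=> i _; rewrite mxE.
  rewrite -(big_mkord xpredT (fun i => if (r <= i)%N then 'X - a%:P else 1)).
  have rn : (r <= n)%N by apply: leq_trans hr; apply: leq_addr.
  rewrite (big_cat_nat (n := r)) //= big_nat big1 => [|i /andP[_ ir]]; last first.
    by rewrite leqNgt ir.
  rewrite mul1r -prodr_const_nat big_nat [RHS]big_nat.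
  by apply: eq_bigr => i /andP[->].
by apply: dvdp_exp2l; rewrite leq_subRL // (leq_trans _ hr) // leq_addr.
Qed.

Lemma prod_dvdp_coprime (F : fieldType) (s : seq nat) (P : nat -> {poly F}) (f : {poly F}) :
  uniq s -> {in s &, forall i j, i != j -> coprimep (P i) (P j)} ->
  {in s, forall i, P i %| f} -> \prod_(i <- s) P i %| f.
Proof.
elim: s => [|k s IHs] /=; first by rewrite big_nil dvd1p.
move=> /andP[ks us] cop dv; rewrite big_cons Gauss_dvdp.
  rewrite dv ?mem_head //= IHs // => [i j si sj|i si]; last by apply: dv; rewrite inE si orbT.
  by apply: cop; rewrite inE ?si ?sj orbT.
rewrite big_seq; elim/big_rec: _ => [|j p sj cp]; first exact: coprimep1.
rewrite coprimepMr cp andbT; apply: cop; rewrite ?mem_head //.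
  by rewrite inE sj orbT.
by apply: contraNneq ks => ->.
Qed.

(** * Weighted inclusion matrices *)

Section WeightedInclusion.
Variables (F : realFieldType) (N : nat) (p : F).
Hypothesis p_gt0 : 0 < p.
Implicit Types (S T J U : {set 'I_N}).

Definition below (T : {set 'I_N}) (j : nat) : nat := #|[set t in T | (t < j)%N]|.

(** The weights [p ^+ inversions T (S :\: T)] form a p-analogue of the inclusion matrix: summed over
    the [T] of a fixed size they give a Gaussian binomial. *)
Definition inversions (T J : {set 'I_N}) : nat := (\sum_(j in J) below T j)%N.

Lemma below_subU S T j : T \subset S -> (below S j = below T j + below (S :\: T) j)%N.
Proof.
move=> TS; rewrite /below -cardsUI; set A := _ :&: _.
have -> : A = set0.
  by apply/setP => u; rewrite !inE; case: (u \in T); rewrite ?andbF.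
rewrite cards0 addn0; apply: eq_card => u; rewrite !inE.
by case: (u \in T) / boolP => [/(subsetP TS) ->|_] /=; rewrite ?orbF.
Qed.

(** Counting from 0 in increasing order, the element number [i] of [J] has [i] elements of [J] below
    it. The induction removes the largest one. *)
Lemma geometric_below J : \sum_(j in J) p ^+ below J j = \sum_(i < #|J|) p ^+ i.
Proof.
have [m] := ubnP #|J|; elim: m J => // m IHm J.
have [->|[j0 Jj0]] := set_0Vmem J; first by rewrite cards0 big_set0 big_ord0.
case: (@arg_maxnP _ j0 (fun j => j \in J) (@nat_of_ord N) Jj0) => o Jo omax leJ.
have cJ := cardsD1 o J; rewrite Jo add1n in cJ.
rewrite (big_setD1 o) //= cJ big_ord_recr /= addrC; congr (_ + _); last first.
  congr (_ ^+ _); apply/eqP; rewrite -eqSS -cJ /below; apply/eqP.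
  rewrite (cardsD1 o J) Jo add1n; congr _.+1; apply: eq_card => u; rewrite !inE.
  have [->|uo] := eqVneq u o; first by rewrite ltnn andbF.
  case: (u \in J) / boolP => //= Ju; rewrite ltn_neqAle val_eqE uo; exact: omax.
rewrite -IHm; last by rewrite cJ in leJ.
apply: eq_bigr => j; rewrite !inE => /andP[jo Jj]; congr (_ ^+ _).
apply: eq_card => u; rewrite !inE; have [->|//] := eqVneq u o; rewrite ltnNge.
by have /= -> := omax j Jj; rewrite ?andbF.
Qed.

(** A set [T] is reached once for each [j] in [S :\: T]. The exponent splits into
    [inversions T (S :\: T)] and [below (S :\: T) j], and [geometric_below] sums the latter. *)
Lemma inclusion_compose S (c : nat) (h : {set 'I_N} -> F) :
  \sum_(j in S) p ^+ below S j *
     (\sum_(T : {set 'I_N} | (T \subset S :\ j) && (#|T| == c))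
        p ^+ inversions T ((S :\ j) :\: T) * h T) =
  (\sum_(i < #|S| - c) p ^+ i) *
     \sum_(T : {set 'I_N} | (T \subset S) && (#|T| == c)) p ^+ inversions T (S :\: T) * h T.
Proof.
under eq_bigr => j _ do rewrite mulr_sumr.
rewrite (exchange_big_dep (fun T : {set 'I_N} => (T \subset S) && (#|T| == c))) /=; last first.
  move=> j T _ /andP[TS ->]; rewrite andbT.
  exact: subset_trans TS (subsetDl _ _).
rewrite mulr_sumr; apply: eq_bigr => T /andP[TS /eqP cT].
have -> : (#|S| - c = #|S :\: T|)%N by rewrite cardsD (setIidPr TS) cT.
rewrite -geometric_below mulr_suml; apply: eq_big => [j|j].
  by rewrite cT eqxx andbT subsetD1 TS /= inE andbC.
move=> /andP[Sj]; rewrite subsetD1 => /andP[/andP[_ Tj] _].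
rewrite !mulrA -!exprD; congr (_ ^+ _ * _).
rewrite [inversions T (S :\: T)](big_setD1 j) /=; last by rewrite inE Tj.
rewrite (below_subU j TS) -/(inversions _ _) setDDl setUC -setDDl.
by rewrite addnCA addnA.
Qed.

Lemma inversions_top (o : 'I_N) T J :
  (forall t, t \in T -> (t < o)%N) -> o \notin J ->
  inversions T (o |: J) = (#|T| + inversions T J)%N.
Proof.
move=> To oJ; rewrite /inversions big_setU1 //=; congr (_ + _)%N.
by apply: eq_card => t; rewrite inE; case: (t \in T) / boolP => // /To ->.
Qed.

Lemma inversionsU1 (o : 'I_N) T J :
  (forall j, j \in J -> (j < o)%N) -> inversions (o |: T) J = inversions T J.
Proof.
move=> Jo; apply: eq_bigr => j /Jo jo; apply: eq_card => t; rewrite !inE.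
have [->|//] := eqVneq t o; by rewrite ltnNge (ltnW jo) !andbF.
Qed.

(** A Pascal recursion on whether [T] contains the largest point [o]: if not, [o] lies above all [a]
    points of [T]; if so, it creates no inversion. *)
Lemma inclusion_split (o : 'I_N) S a (g : {set 'I_N} -> F) :
  (forall t, t \in S -> (t < o)%N) ->
  \sum_(T : {set 'I_N} | (T \subset o |: S) && (#|T| == a))
     p ^+ inversions T ((o |: S) :\: T) * g T =
  p ^+ a * (\sum_(T : {set 'I_N} | (T \subset S) && (#|T| == a))
     p ^+ inversions T (S :\: T) * g T) +
  \sum_(T : {set 'I_N} | (T \subset S) && (#|T|.+1 == a))
     p ^+ inversions T (S :\: T) * g (o |: T).
Proof.
move=> So; have oS : o \notin S by apply/negP => /So; rewrite ltnn.
rewrite (bigID (fun T : {set 'I_N} => o \in T)) /= addrC; congr (_ + _).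
  rewrite mulr_sumr; apply: eq_big => [T|T /andP[/andP[TS /eqP cT] oT]].
    by rewrite andbAC -subsetD1 setU1K.
  have oTS : T \subset S by rewrite -(setU1K oS) subsetD1 TS.
  rewrite setDUl; have -> : [set o] :\: T = [set o].
    by apply/setP => u; rewrite !inE; have [->|//] := eqVneq u o; rewrite ?oT ?andbT ?andbF.
  rewrite inversions_top ?cT ?exprD ?mulrA // => [t Tt|].
    by apply: So; apply: (subsetP oTS).
  by rewrite inE (negPf oS) andbF.
rewrite (reindex_onto (fun T => o |: T) (fun T => T :\ o)) /=; last first.
  by move=> T /andP[_ oT]; rewrite setD1K.
apply: eq_big => [T|T /andP[/andP[/andP[TS _] _] /eqP Te]].
  rewrite setU11 andbT; have [oT|oT] := boolP (o \in T).
    have -> : (o |: T) :\ o == T = false.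
      by apply/negP => /eqP E; move: oT; rewrite -E !inE eqxx.
    rewrite andbF; symmetry; apply/negP => /andP[/subsetP/(_ o oT)] .
    by rewrite (negPf oS).
  rewrite (setU1K oT) eqxx andbT cardsU1 oT add1n; congr (_ && _).
  by rewrite subUset sub1set setU11 /= -[in RHS](setU1K oS) subsetD1 oT andbT.
have oT : o \notin T by rewrite -Te !inE eqxx.
rewrite inversionsU1 => [|j].
  congr (p ^+ inversions _ _ * _); apply/setP => u; rewrite !inE.
  by have [->|_] := eqVneq u o; rewrite //= (negPf oS) andbF.
by rewrite !inE negb_or -andbA => /and3P[uo _]; rewrite (negPf uo) => /So.
Qed.

Lemma inclusion_diag x a (g : {set 'I_N} -> F) :
  (forall S, (forall i, i \in S -> (i < x)%N) -> #|S| = a ->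
     \sum_(T : {set 'I_N} | (T \subset S) && (#|T| == a))
        p ^+ inversions T (S :\: T) * g T = 0) ->
  forall T, (forall i, i \in T -> (i < x)%N) -> #|T| = a -> g T = 0.
Proof.
move=> h T Tx cT; have := h T Tx cT; rewrite (big_pred1 T) => [|U].
  by rewrite setDv /inversions big_set0 expr0 mul1r.
rewrite /= eqEcard cT; have [UT|//] := boolP (U \subset T).
by rewrite eqn_leq -{1}cT subset_leq_card.
Qed.

(* Induction on the largest point [o]: summing the equations for the sets [o |: S'] over
   [S' \subset S] eliminates the values at the sets avoiding [o]. *)
Lemma weighted_inclusion_inj x a b (g : {set 'I_N} -> F) :
  (x <= N)%N -> (a <= b)%N -> (a + b <= x)%N ->
  (forall S, (forall i, i \in S -> (i < x)%N) -> #|S| = b ->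
     \sum_(T : {set 'I_N} | (T \subset S) && (#|T| == a))
        p ^+ inversions T (S :\: T) * g T = 0) ->
  forall T, (forall i, i \in T -> (i < x)%N) -> #|T| = a -> g T = 0.
Proof.
elim: x a b g => [|x IHx] a b g xN; rewrite leq_eqVlt => /predU1P[<- _|ab abx] h T Tx cT.
- exact: (inclusion_diag h Tx cT).
- by lia.
- exact: (inclusion_diag h Tx cT).
case: b ab abx h => // b; rewrite ltnS addnS ltnS => ab abx h.
pose o := Ordinal xN.
have ltxS S : (forall i, i \in S -> (i < x)%N) -> forall i, i \in S -> (i < x.+1)%N.
  by move=> Sx i /Sx /ltnW.
have E1 S : (forall i, i \in S -> (i < x)%N) -> #|S| = b ->
    p ^+ a * (\sum_(T : {set 'I_N} | (T \subset S) && (#|T| == a))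
       p ^+ inversions T (S :\: T) * g T) +
    \sum_(T : {set 'I_N} | (T \subset S) && (#|T|.+1 == a))
       p ^+ inversions T (S :\: T) * g (o |: T) = 0.
  move=> Sx cS; rewrite -inclusion_split //; apply: h.
    by move=> i; rewrite !inE => /predU1P[->|/ltxS]; [exact: ltnSn|exact].
  by rewrite cardsU1 cS; case: (o \in S) / boolP => // /Sx; rewrite ltnn.
have g1 U : (forall i : 'I_N, i \in U -> (i < x)%N) -> #|U|.+1 = a -> g (o |: U) = 0.
  case: a abx ab {h cT} E1 (h) => [//|a] abx ab E1 h Ux [cU].
  apply: (IHx a b.+1 (fun V => g (o |: V)) (ltnW xN)) Ux cU; rewrite ?addnS //.
    by rewrite ltnW // ltnW.
  move=> S Sx cS.
  have : \sum_(j in S) p ^+ below S j * 0 = 0 :> F.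
    by rewrite big1 // => j _; rewrite mulr0.
  under eq_bigr => j Sj.
    rewrite -(E1 (S :\ j)).
    - rewrite mulrDr mulrCA; over.
    - by move=> i /setD1P[_ /Sx].
    - by apply/eqP; rewrite -eqSS -cS (cardsD1 j S) Sj.
  rewrite big_split /= -mulr_sumr inclusion_compose h //; last exact: ltxS.
  rewrite !mulr0 add0r.
  under eq_bigr => j _ do under eq_bigl => U' do rewrite eqSS.
  rewrite inclusion_compose => /eqP; rewrite mulf_eq0 => /orP[|/eqP //].
  (* The factor is the p-integer of [b.+1 - a], which is positive because [p > 0]. *)
  rewrite cS subSn; last exact: ltnW.
  rewrite big_ord_recl expr0 => /eqP E; exfalso.
  have : 0 < 1 + \sum_(i < b - a) p ^+ lift ord0 i.
    by rewrite ltr_pwDl // sumr_ge0 // => i _; rewrite exprn_ge0 // ltW.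
  by rewrite E ltxx.
have [oT|oT] := boolP (o \in T).
  rewrite -(setD1K oT) g1 //; last by rewrite -cT (cardsD1 o T) oT.
  move=> i /setD1P[io /Tx]; rewrite ltnS leq_eqVlt => /orP[/eqP ix|//].
  by case/eqP: io; apply: val_inj.
(* With the values at sets containing [o] gone, [E1] is [p ^+ a] times the system on the points
   below [o]. *)
apply: (IHx a b g (ltnW xN) ab abx) => // [S Sx cS|i Ti].
  have := E1 S Sx cS; rewrite [X in _ + X]big1 => [|U /andP[US /eqP cU]]; last first.
    by rewrite g1 ?mulr0 // => i /(subsetP US)/Sx.
  by rewrite addr0 => /eqP; rewrite mulf_eq0 expf_eq0 (gt_eqF p_gt0) andbF => /eqP.
have := Tx i Ti; rewrite ltnS leq_eqVlt => /orP[/eqP ix|//].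
by case/negP: oT; rewrite (_ : o = i) //; apply: val_inj.
Qed.
End WeightedInclusion.

(** * Noncrossing arcs and the rotation number of a loop *)

Section Arcs.
Variable n : nat.
Implicit Types (M : pts n -> pts n) (S T : {set pts n}) (p a b : pts n).

(** [M] is constrained on [S] alone, so that the notion serves for a whole connection, for one glued
    curve and for the smaller curves in the induction on the rotation number. *)
Record arcs_on M S : Prop := ArcsOn {
  arcs_in : forall p, p \in S -> M p \in S;
  arcsK : forall p, p \in S -> M (M p) = p;
  arcs_neq : forall p, p \in S -> M p != p :> nat;
  arcs_nc : forall a b, a \in S -> b \in S ->
              ~~ [&& (a < b)%N, (b < M a)%N & (M a < M b)%N] }.

(** [M] matches the left ends in [S] bijectively with the right ends. *)
Lemma involution_even M S :
  (forall p, p \in S -> [/\ M p \in S, M (M p) = p & M p != p :> nat]) -> ~~ odd #|S|.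
Proof.
move=> hM; pose L := [set p in S | (p < M p)%N].
suff -> : #|S| = #|L|.*2 by rewrite odd_double.
have SL : S :\: L = M @: L.
  apply/setP => p; rewrite !inE; apply/andP/imsetP => [[pL pS]|[u]].
    exists (M p); last by have [] := hM p pS.
    have [MS MMp np] := hM p pS; rewrite inE MS MMp /=.
    by move: pL np; rewrite pS /=; lia.
  rewrite inE => /andP[uS lu] ->; have [MS MMu _] := hM u uS.
  by rewrite MS MMu /=; split=> //; lia.
rewrite -(cardsID L S) SL card_in_imset; last first.
  move=> u v /setIdP[uS _] /setIdP[vS _] E.
  by have [_ <- _] := hM u uS; rewrite E; have [] := hM v vS.
rewrite (setIidPr _) ?addnn //; by apply/subsetP => u /setIdP[].
Qed.

Lemma arc_inner M S a p : arcs_on M S -> a \in S -> (a < M a)%N -> p \in S ->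
  (a < p < M a)%N -> (a < M p < M a)%N.
Proof.
move=> [Mi MK Mn Mc] aS la pS /andP[ap pa].
have npa : M p <> a by move=> E; move: pa; rewrite -E MK // ltnn.
have npMa : M p <> M a by move=> E; move: ap; rewrite -(MK p) // E MK // ltnn.
have h1 := Mc a p aS pS; have h2 := Mc (M p) a (Mi p pS) aS.
rewrite MK // in h2.
have {}npa : M p <> a :> nat by move/val_inj.
have {}npMa : M p <> M a :> nat by move/val_inj.
lia.
Qed.

Lemma inner_even M S a : arcs_on M S -> a \in S -> (a < M a)%N ->
  ~~ odd #|[set p in S | (a < p < M a)%N]|.
Proof.
move=> hM aS la; apply: (@involution_even M) => p /setIdP[pS ap].
rewrite inE (arcs_in hM) // (arc_inner hM aS la) // (arcsK hM) //.
by split=> //; apply: (arcs_neq hM).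
Qed.

Lemma side_split S a b : (a < b)%N -> side S b =
  side S a (+) odd #|[set p in S | (a < p < b)%N]| (+) (b \in S).
Proof.
move=> ab; rewrite /side.
have -> : [set u in S | (u <= b)%N] = [set u in S | (u <= a)%N] :|:
            ([set p in S | (a < p < b)%N] :|: (S :&: [set b])).
  apply/setP => u; rewrite !inE; case: (u \in S) => //=.
  by rewrite -val_eqE /=; lia.
rewrite cardsU [X in (_ - X)%N](_ : _ = 0%N); last first.
  apply/eqP; rewrite cards_eq0; apply/eqP/setP => u; rewrite !inE.
  by case: (u \in S) => //=; rewrite -val_eqE /=; lia.
rewrite subn0 oddD; rewrite cardsU [X in (_ - X)%N](_ : _ = 0%N); last first.
  apply/eqP; rewrite cards_eq0; apply/eqP/setP => u; rewrite !inE.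
  by case: (u \in S) => //=; rewrite -val_eqE /=; lia.
rewrite subn0 oddD addbA; congr (_ (+) _).
have [bS|bS] := boolP (b \in S).
  by rewrite (setIidPr _) ?cards1 // sub1set.
rewrite [_ :&: _](_ : _ = set0) ?cards0 //; apply/setP => u; rewrite !inE.
by have [->|] := eqVneq u b; rewrite ?(negPf bS) // andbF.
Qed.

(** The points of [S] strictly under an arc of [S] come in pairs, so only the far end of the arc
    changes the parity. *)
Lemma side_arc M S p : arcs_on M S -> p \in S -> side S (M p) = ~~ side S p.
Proof.
move=> hM pS.
wlog lp : p pS / (p < M p)%N => [hw|].
  case: (ltngtP p (M p)) => [|lt|E]; first exact: hw.
    by have := hw (M p) (arcs_in hM pS); rewrite (arcsK hM pS) => ->; rewrite ?negbK.
  by have := arcs_neq hM pS; rewrite -E eqxx.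
rewrite (side_split S lp) (arcs_in hM) // (negPf (inner_even hM pS lp)).
by rewrite addbF addbT.
Qed.

(** As no arcs cross, an arc of [S] starting under [{a, M a}] also ends there, so these arcs
    contribute an even number of points. *)
Lemma side_arc_outside M S a : arcs_on M setT -> arcs_on M S -> a \notin S ->
  side S (M a) = side S a.
Proof.
move=> hT hM aS.
wlog lp : a aS / (a < M a)%N => [hw|].
  case: (ltngtP a (M a)) => [|lt|E]; first exact: hw.
    have := hw (M a); rewrite (arcsK hT (in_setT a)) => -> //.
    by apply/negP => /(arcs_in hM); rewrite (arcsK hT (in_setT a)) (negPf aS).
  by have := arcs_neq hT (in_setT a); rewrite -E eqxx.
rewrite (side_split S lp) [M a \in S](_ : _ = false); last first.
  by apply/negP => /(arcs_in hM); rewrite (arcsK hT (in_setT a)) (negPf aS).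
rewrite addbF (negPf (_ : ~~ odd _)) ?addbF //.
apply: (@involution_even M) => p /setIdP[pS ap].
rewrite inE (arcs_in hM) // (arc_inner hT (in_setT a) lp (in_setT p) ap) (arcsK hM) //.
by split=> //; apply: (arcs_neq hM).
Qed.

Lemma innermost_arc M S : arcs_on M S -> S != set0 ->
  exists i, [/\ i \in S, (i < M i)%N & forall p, p \in S -> ~~ (i < p < M i)%N].
Proof.
move=> hM /set0Pn[x xS].
have [i0 /andP[i0S li0]] : exists i, (i \in S) && (i < M i)%N.
  case: (ltngtP x (M x)) => [lt|lt|E]; first by exists x; rewrite xS.
    by exists (M x); rewrite (arcs_in hM) // (arcsK hM).
  by have := arcs_neq hM xS; rewrite -E eqxx.
case: (@arg_minnP _ i0 (fun i => (i \in S) && (i < M i)%N) (fun i => M i - i)%N).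
  by rewrite i0S.
move=> i /andP[iS li] imin; exists i; split=> // p pS; apply/negP => ip.
have iMp := arc_inner hM iS li pS ip.
case: (ltngtP p (M p)) => [lt|lt|E].
- by have := imin p; rewrite pS lt => /(_ isT); lia.
- have := imin (M p); rewrite (arcs_in hM) // (arcsK hM) // lt => /(_ isT); lia.
- by have := arcs_neq hM pS; rewrite -E eqxx.
Qed.

(** Connectedness of the curve, phrased through stable subsets so that it passes easily to the curve
    with an arc removed. *)
Definition loop M1 M2 S : Prop := forall T, T \subset S -> T != set0 ->
  (forall p, p \in T -> M1 p \in T) -> (forall p, p \in T -> M2 p \in T) -> T = S.

(** The direction of the crossing at [p] for one orientation of [S]. The product [eps S p * tau M p]
    agrees at both ends of an arc and is its half-turn. *)
Definition eps S p : int := if side S p then 1 else -1.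
Definition tau M p : int := if (p < M p)%N then 1 else -1.

End Arcs.

(** * Rotation number of a connected curve *)

Lemma gap_ltn (i j p : nat) : ~~ (i < p < j)%N -> p != i -> p != j -> (i < j)%N ->
  ((i < p) = (j < p))%N * ((p < i) = (p < j))%N * ((i <= p) = (j <= p))%N.
Proof. by move=> *; do 2?split; lia. Qed.

Lemma crossing_xor (a b c d : nat) : (a < b)%N -> (b < c)%N -> (c < d)%N ->
  (a < b)%N (+) (c < b)%N = (a < d)%N (+) (c < d)%N -> False.
Proof. lia. Qed.

Section Rotation.
Variable n : nat.
Implicit Types (M : pts n -> pts n) (S T : {set pts n}) (p a b : pts n).

(** Noncrossing as a parity of ends lying to the left. This form can be added over two arcs, which
    is how it passes to an arc replacing them. *)
Lemma arcs_xor M S a b : arcs_on M S -> a \in S -> b \in S ->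
  b != a -> b != M a ->
  (a < b)%N (+) (M a < b)%N = (a < M b)%N (+) (M a < M b)%N.
Proof.
move=> hM aS bS ba bMa.
have bMa' : (M b != a) by apply: contraNneq bMa => <-; rewrite (arcsK hM).
have bMa2 : (M b != M a).
  by apply: contraNneq ba => E; rewrite -(arcsK hM bS) E (arcsK hM).
wlog la : a aS ba bMa bMa' bMa2 / (a < M a)%N => [hw|].
  have [|lt|E] := ltngtP a (M a); first exact: hw.
    have := hw (M a) (arcs_in hM aS) bMa; rewrite (arcsK hM aS) => /(_ ba bMa2 bMa' lt).
    by rewrite addbC => ->; rewrite addbC.
  by have := arcs_neq hM aS; rewrite -E eqxx.
have h1 := arc_inner hM aS la bS; have h2 := arc_inner hM aS la (arcs_in hM bS).
rewrite (arcsK hM bS) in h2; move: ba bMa bMa' bMa2; rewrite -!val_eqE /= => ba bMa bMa' bMa2.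
suff E : (a < b < M a)%N = (a < M b < M a)%N by lia.
by apply/idP/idP.
Qed.

(* The signs [eps] alternate along the line and orient the loop, so the sum is twice the
   number of half-turns.  The induction removes an innermost arc [{i, j}] of [M1] and
   joins the [M2]-partners of [i] and [j], which does not change the sum. *)
Lemma loop_rotation M1 M2 S :
  arcs_on M1 S -> arcs_on M2 S -> S != set0 -> loop M1 M2 S ->
  \sum_(p in S) eps S p * (tau M1 p + tau M2 p) = 4.
Proof.
have [m] := ubnP #|S|; elim: m S M2 => // m IHm S M2 leS hM1 hM2 S0 con.
have [i [iS ij gap]] := innermost_arc hM1 S0.
have jS := arcs_in hM1 iS; have Mj := arcsK hM1 iS.
move Ej: (M1 i) => j in ij gap jS Mj.
have nij : i != j by rewrite -val_eqE /=; lia.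
have epsM M p : arcs_on M S -> p \in S -> eps S (M p) = - eps S p.
  by move=> hM pS; rewrite /eps (side_arc hM pS); case: (side S p).
have epsj : eps S j = - eps S i by rewrite -Ej (epsM M1).
have [E2|N2] := eqVneq (M2 i) j.
  (* The base case: [S] consists of [i] and [j], and each of them contributes 2. *)
  have M2j : M2 j = i by rewrite -E2 (arcsK hM2).
  have SE : [set i; j] = S.
    apply: con; first by rewrite subUset !sub1set iS.
    - by apply/set0Pn; exists i; rewrite !inE eqxx.
    - by move=> p /set2P[] ->; rewrite !inE ?Ej ?Mj eqxx ?orbT.
    - by move=> p /set2P[] ->; rewrite !inE ?E2 ?M2j eqxx ?orbT.
  rewrite -{1}SE big_setU1 ?big_set1 ?inE //= epsj.
  have -> : eps S i = 1.
    rewrite /eps /side [X in #|pred_of_set X|](_ : _ = [set i]) ?cards1 //.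
    rewrite -SE; apply/setP => u; rewrite !inE.
    by rewrite -!val_eqE /=; lia.
  by rewrite /tau Ej Mj E2 M2j ij ltnNge (ltnW ij).
have M2K := arcsK hM2; have M2i := arcs_in hM2.
move Ei': (M2 i) => i' in N2; move Ej': (M2 j) => j'.
have i'S : i' \in S by rewrite -Ei' M2i.
have j'S : j' \in S by rewrite -Ej' M2i.
have Mi' : M2 i' = i by rewrite -Ei' M2K.
have Mj' : M2 j' = j by rewrite -Ej' M2K.
have ni'i : i' != i by rewrite -val_eqE /= -Ei' (arcs_neq hM2).
have nj'j : j' != j by rewrite -val_eqE /= -Ej' (arcs_neq hM2).
have nj'i : j' != i by apply: contraNneq N2 => E; rewrite -Mj' E Ei'.
have ni'j' : i' != j' by apply: contraNneq nij => E; rewrite -Mi' E Mj'.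
pose S' := S :\ i :\ j.
pose M2' p := if p == i' then j' else if p == j' then i' else M2 p.
have S'P p : p \in S' -> [/\ p \in S, p != i & p != j].
  by rewrite !inE => /and3P[-> -> ->].
have inS' p : p \in S -> p != i -> p != j -> p \in S'.
  by move=> pS pi pj; rewrite !inE pS pi pj.
have hM1' : arcs_on M1 S'.
  split=> [p|p|p|a b] /S'P[pS pi pj].
  - apply: inS'; first exact: (arcs_in hM1).
      by apply: contraNneq pj => E; rewrite -Ej -E (arcsK hM1).
    by apply: contraNneq pi => E; rewrite -Mj -E (arcsK hM1).
  - exact: (arcsK hM1).
  - exact: (arcs_neq hM1).
  - by move=> /S'P[bS _ _]; apply: (arcs_nc hM1).
have M2S p : p \in S' -> p != i' -> p != j' ->
    [/\ M2 p \in S', M2 p != i' & M2 p != j'].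
  move=> /S'P[pS pi pj] pi' pj'; split.
  - apply: inS'; first exact: M2i.
      by apply: contraNneq pi' => E; rewrite -Ei' -E M2K.
    by apply: contraNneq pj' => E; rewrite -Ej' -E M2K.
  - by apply: contraNneq pi => E; rewrite -(M2K p pS) E Mi'.
  - by apply: contraNneq pj => E; rewrite -(M2K p pS) E Mj'.
have M2'i' : M2' i' = j' by rewrite /M2' eqxx.
have M2'j' : M2' j' = i' by rewrite /M2' eqxx eq_sym (negPf ni'j').
have M2'E p : p != i' -> p != j' -> M2' p = M2 p.
  by rewrite /M2' => /negPf -> /negPf ->.
have i'S' : i' \in S' by apply: inS'.
have j'S' : j' \in S' by apply: inS'.
have gapE p : p \in S' -> (i < p)%N = (j < p)%N.
  by move=> /S'P[pS pi pj]; rewrite (gap_ltn (gap p pS) pi pj ij).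
have gapE' p : p \in S' -> (p < i)%N = (p < j)%N.
  by move=> /S'P[pS pi pj]; rewrite (gap_ltn (gap p pS) pi pj ij).
have hM2' : arcs_on M2' S'.
  split=> [p pS'|p pS'|p pS'|a b aS' bS'].
  - have [->|pi'] := eqVneq p i'; first by rewrite M2'i'.
    have [->|pj'] := eqVneq p j'; first by rewrite M2'j'.
    by rewrite M2'E //; have [] := M2S p.
  - have [->|pi'] := eqVneq p i'; first by rewrite M2'i'.
    have [->|pj'] := eqVneq p j'; first by rewrite M2'j'.
    rewrite (M2'E p) //; have [_ ? ?] := M2S p pS' pi' pj'.
    by rewrite M2'E // M2K //; have [] := S'P p pS'.
  - have [->|pi'] := eqVneq p i'; first by rewrite M2'i' val_eqE eq_sym.
    have [->|pj'] := eqVneq p j'; first by rewrite M2'j' val_eqE.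
    by rewrite M2'E // (arcs_neq hM2) //; have [] := S'P p pS'.
  apply/negP => /and3P[ab bMa MaMb].
  (* The parity condition for [M2'] follows from those for the arcs [{i, i'}] and [{j, j'}], since
     no point of [S'] separates [i] from [j]. *)
  apply: (crossing_xor ab bMa MaMb).
  have ba : b != a by rewrite -val_eqE gtn_eqF.
  have bMa' : b != M2' a by rewrite -val_eqE ltn_eqF.
  have [aS ai aj] := S'P a aS'; have [bS bi bj] := S'P b bS'.
  have [aij|aij] := boolP (a \in [:: i'; j']).
    have nbi' : b != i'.
      by move: aij; rewrite !inE => /orP[]/eqP E; rewrite E ?M2'i' ?M2'j' in ba bMa'.
    have nbj' : b != j'.
      by move: aij; rewrite !inE => /orP[]/eqP E; rewrite E ?M2'i' ?M2'j' in ba bMa'.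
    have [MbS' _ _] := M2S b bS' nbi' nbj'.
    have h1 := arcs_xor hM2 iS bS bi; rewrite Ei' in h1; have {}h1 := h1 nbi'.
    have h2 := arcs_xor hM2 jS bS bj; rewrite Ej' in h2; have {}h2 := h2 nbj'.
    rewrite (M2'E b) //; have g1 := gapE b bS'; have g2 := gapE _ MbS'.
    by move: aij; rewrite !inE => /orP[]/eqP ->; rewrite ?M2'i' ?M2'j'; move: h1 h2 g1 g2;
      do 8! case: (leqP _.+1 _) => _.
  move: aij; rewrite !inE negb_or => /andP[ai' aj'].
  have [MaS' _ _] := M2S a aS' ai' aj'; rewrite (M2'E a) // in bMa' *.
  have [bij|bij] := boolP (b \in [:: i'; j']); last first.
    move: bij; rewrite !inE negb_or => /andP[bi' bj']; rewrite M2'E //.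
    exact: (arcs_xor hM2).
  have nMai : i != M2 a by rewrite eq_sym; have [] := S'P _ MaS'.
  have nMaj : j != M2 a by rewrite eq_sym; have [] := S'P _ MaS'.
  have h1 := arcs_xor hM2 aS iS; rewrite eq_sym Ei' in h1; have {}h1 := h1 ai nMai.
  have h2 := arcs_xor hM2 aS jS; rewrite eq_sym Ej' in h2; have {}h2 := h2 aj nMaj.
  have g1 := gapE' a aS'; have g2 := gapE' _ MaS'.
  by move: bij; rewrite !inE => /orP[]/eqP ->; rewrite ?M2'i' ?M2'j'; move: h1 h2 g1 g2;
      do 8! case: (leqP _.+1 _) => _.
have con' : loop M1 M2' S'.
  move=> T TS' T0 T1 T2.
  have [i'T|i'T] := boolP (i' \in T); last first.
    have j'T : j' \notin T.
      by apply: contraNN i'T => /T2; rewrite M2'j'.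
    have TS : T = S.
      apply: con => // [|p pT].
        by apply/subsetP => p /(subsetP TS')/S'P[].
      have pi' : p != i' by apply: contraNneq i'T => <-.
      have pj' : p != j' by apply: contraNneq j'T => <-.
      by rewrite -(M2'E p pi' pj') T2.
    by have := subsetP TS' i; rewrite TS iS => /(_ isT)/S'P[_]; rewrite eqxx.
  have j'T : j' \in T by rewrite -M2'i' T2.
  have TS : i |: (j |: T) = S.
    apply: con.
    - rewrite !subUset !sub1set iS jS /=.
      by apply/subsetP => p /(subsetP TS')/S'P[].
    - by apply/set0Pn; exists i; rewrite setU11.
    - move=> p /setU1P[->|/setU1P[->|pT]]; rewrite ?Ej ?Mj !inE ?eqxx ?orbT //.
      by rewrite T1 // !orbT.
    - move=> p /setU1P[->|/setU1P[->|pT]]; rewrite ?Ei' ?Ej' !inE ?i'T ?j'T ?orbT //.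
      have [->|pi'] := eqVneq p i'; first by rewrite Mi' eqxx.
      have [->|pj'] := eqVneq p j'; first by rewrite Mj' eqxx ?orbT.
      by rewrite -(M2'E p pi' pj') T2 // !orbT.
  apply/eqP; rewrite eqEsubset TS' /=; apply/subsetP => p /S'P[].
  by rewrite -TS !inE => /or3P[->|->|->].
have epsE p : p \in S' -> eps S' p = eps S p.
  move=> pS'; have g := gapE p pS'; have [pS pi pj] := S'P p pS'.
  rewrite /eps; congr (if _ then _ else _); rewrite /side.
  have -> : [set u in S' | (u <= p)%N] = [set u in S | (u <= p)%N] :\ i :\ j.
    by apply/setP => u; rewrite !inE -!andbA.
  rewrite [in RHS](cardsD1 i) [in RHS](cardsD1 j) !inE iS jS (eq_sym j i) nij /=.
  have -> : (i <= p)%N = (j <= p)%N.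
    by rewrite (gap_ltn (gap p pS) pi pj ij).
  by rewrite !oddD addbA addbb.
have IH := IHm S' M2' _ hM1' hM2' _ con'.
have {IH} : \sum_(p in S') eps S p * (tau M1 p + tau M2' p) = 4.
  rewrite -IH; first by apply: eq_bigr => p pS'; rewrite epsE.
    move: leS; rewrite (cardsD1 i S) iS (cardsD1 j (S :\ i)) !inE eq_sym nij jS /= -/S'.
    by rewrite !add1n ltnS => /ltnW.
  by apply/set0Pn; exists i'.
have -> : \sum_(p in S') eps S p * (tau M1 p + tau M2' p) =
   \sum_(p in S') eps S p * (tau M1 p + tau M2 p) +
   \sum_(p in S') eps S p * (tau M2' p - tau M2 p).
  by rewrite -big_split; apply: eq_bigr => p _ /=; ring.
have -> : \sum_(p in S') eps S p * (tau M2' p - tau M2 p) =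
   eps S i' * (tau M2' i' - tau M2 i') + eps S j' * (tau M2' j' - tau M2 j').
  rewrite (bigD1 i') //= (bigD1 j') /=; last by rewrite j'S' eq_sym.
  rewrite big1 ?addr0 // => p /andP[/andP[pS' pi'] pj'].
  by rewrite /tau M2'E // subrr mulr0.
rewrite [in X in _ -> X](bigD1 i) //= [in X in _ -> X](bigD1 j) /=; last by rewrite jS eq_sym.
rewrite [X in _ -> _ + (_ + X) = _](eq_bigl (fun p => p \in S')); last first.
  by move=> p; rewrite !inE; case: (p \in S); case: (p == i); case: (p == j).
(* The terms of [i] and [j] must equal the change at [i'] and [j']. This depends only on the order
   of the four points, and [h] excludes the crossing orders. *)
move=> <-; rewrite [in RHS]addrC addrA; congr (_ + _).
have ei' : eps S i' = - eps S i by rewrite -Ei' (epsM M2).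
have ej' : eps S j' = eps S i by rewrite -Ej' (epsM M2) // epsj opprK.
rewrite epsj ei' ej' /tau M2'i' M2'j' Mi' Mj' Ei' Ej' Ej Mj ij (ltnNge j i) (ltnW ij) /=.
have h := arcs_xor hM2 iS j'S nj'i; rewrite Ei' Mj' eq_sym in h; have {}h := h ni'j'.
have g1 := gapE _ i'S'; have g2 := gapE _ j'S'.
move: ni'i nj'j ni'j'; rewrite -!val_eqE /=.
move: h g1 g2 ij; move: (eps S i) (nat_of_ord i) (nat_of_ord j) (nat_of_ord i') (nat_of_ord j').
clear => e i j i' j' h g1 g2 ij n1 n2 n3.
have [c|c|c] := ltngtP i i'; have [c2|c2|c2] := ltngtP j j'; have [c3|c3|c3] := ltngtP i' j';
  rewrite ?(leqNgt _ _) /=; try lia.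
Qed.

End Rotation.

(** * Counting the connections avoiding the crosscap *)

Section Counting.
Variable n : nat.
Implicit Types (M : pts n -> pts n) (P u : {set pts n}) (p a b g : pts n).

(* [M] fixes the points outside [P].  The set [u] of minus points is determined by [M] and
   the face of [g]. *)
Record pairing_of P u M g : Prop := PairingOf {
  pairK : forall p, M (M p) = p;
  pair_supp : forall p, (M p != p) = (p \in P);
  pair_nc : forall a b, ~~ [&& (a < b)%N, (b < M a)%N & (M a < M b)%N];
  pair_sign : forall p, p \in P -> (M p \in u) = (p \notin u);
  pair_hole : forall p, p \in P -> (p < M p)%N -> (p \notin u) = ~~ (p <= g < M p)%N }.

Lemma hole_shift (i j g p q : nat) : (i < j)%N -> ~~ (i <= p <= j)%N -> ~~ (i <= q <= j)%N ->
  (p <= (if (i <= g < j)%N then j else g) < q)%N = (p <= g < q)%N.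
Proof. by case: ifP; lia. Qed.

(** Inserting an innermost arc creates no crossing. The gap may move from [g'] to [g] as long as it
    stays on the same side of every older arc. *)
Lemma pairing_step P u M' g' g (i j : pts n) :
  i \in P -> j \in P -> (i < j)%N -> (forall p, p \in P -> ~~ (i < p < j)%N) ->
  (i \in u) = (j \notin u) ->
  pairing_of (P :\ i :\ j) u M' g' ->
  (i \notin u) = ~~ (i <= g < j)%N ->
  (forall p, p \in P :\ i :\ j -> (p < M' p)%N ->
     (p <= g < M' p)%N = (p <= g' < M' p)%N) ->
  exists M, pairing_of P u M g.
Proof.
move=> iP jP ij gap uij [MK Ms Mnc Mu Mh] gi gp.
have nij : j != i by rewrite -val_eqE gtn_eqF.
have M'i : M' i = i by apply/eqP/negPn; rewrite Ms !inE eqxx andbF.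
have M'j : M' j = j by apply/eqP/negPn; rewrite Ms !inE eqxx.
pose M p := if p == i then j else if p == j then i else M' p.
have Mi : M i = j by rewrite /M eqxx.
have Mj : M j = i by rewrite /M (negPf nij) eqxx.
have ME p : p != i -> p != j -> M p = M' p by rewrite /M => /negPf-> /negPf->.
have M'ni p : p != i -> M' p != i by apply: contra_neq => E; rewrite -(MK p) E.
have M'nj p : p != j -> M' p != j by apply: contra_neq => E; rewrite -(MK p) E.
exists M; split=> [p|p|a b|p pP|p pP].
- have [->|pi] := eqVneq p i; first by rewrite Mi Mj.
  have [->|pj] := eqVneq p j; first by rewrite Mj Mi.
  by rewrite (ME p) // ME ?MK ?M'ni ?M'nj.
- have [->|pi] := eqVneq p i; first by rewrite Mi iP.
  have [->|pj] := eqVneq p j; first by rewrite Mj jP eq_sym.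
  by rewrite ME // Ms !inE pi pj.
- apply/negP => /and3P[ab bMa MaMb].
  have inP p : p != i -> p != j -> M p != p -> (p \in P) && (M' p \in P).
    move=> pi pj; rewrite ME // => np.
    have := np; rewrite Ms !inE pi pj /= => ->.
    by have : M' (M' p) != M' p by [rewrite MK eq_sym]; rewrite Ms !inE => /and3P[].
  have bN : M b != b by rewrite -val_eqE gtn_eqF // (ltn_trans bMa).
  have aN : M a != a by rewrite -val_eqE gtn_eqF // (ltn_trans ab).
  have [ai|ai] := eqVneq a i.
    rewrite ai Mi in ab bMa MaMb.
    have bi : b != i by rewrite -val_eqE gtn_eqF.
    have bj : b != j by rewrite -val_eqE ltn_eqF.
    have /andP[bP _] := inP b bi bj bN.
    by have := gap b bP; rewrite ab bMa.
  have [aj|aj] := eqVneq a j; first by rewrite aj Mj in ab bMa; lia.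
  have /andP[aP MaP] := inP a ai aj aN.
  have [bi|bi] := eqVneq b i.
    by rewrite bi Mi ME // in ab bMa MaMb; have := gap _ MaP; rewrite bMa MaMb.
  have [bj|bj] := eqVneq b j; first by rewrite bj Mj in ab bMa MaMb; lia.
  by rewrite !ME // in bMa MaMb; have := Mnc a b; rewrite ab bMa MaMb.
- have [->|pi] := eqVneq p i; first by rewrite Mi uij negbK.
  have [->|pj] := eqVneq p j; first by rewrite Mj.
  by rewrite ME // Mu // !inE pi pj.
- have [->|pi] := eqVneq p i; first by rewrite Mi.
  have [->|pj] := eqVneq p j; first by rewrite Mj ltnNge (ltnW ij).
  have pP' : p \in P :\ i :\ j by rewrite !inE pi pj.
  by rewrite ME // => lp; rewrite Mh // gp.
Qed.

(** Bracket matching around an annulus: a neighbouring plus and minus, in this order, are joined by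
    an arc avoiding the gap. Once every minus precedes every plus, the last minus and the first plus
    are joined by an arc covering it. *)
Lemma pairing_exists (g0 : pts n) m P u : #|P| = m.*2 -> #|P :&: u| = m ->
  exists M g, pairing_of P u M g.
Proof.
elim: m P => [|m IHm] P cP cPu.
  exists id, g0; move/eqP: cP; rewrite cards_eq0 => /eqP ->.
  split=> // [p|a b|p|p]; rewrite ?inE ?eqxx //.
  by apply/negP => /and3P[ab ba]; rewrite ltnNge (ltnW ab) in ba.
have IH (i j : pts n) : i \in P -> j \in P -> (i < j)%N -> (i \in u) = (j \notin u) ->
    exists M' g', pairing_of (P :\ i :\ j) u M' g'.
  move=> iP jP ij uij; have nij : j != i by rewrite -val_eqE gtn_eqF.
  apply: IHm.
    move: cP; rewrite (cardsD1 i P) iP (cardsD1 j (P :\ i)) !inE nij jP /= doubleS !add1n.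
    by case.
  move: cPu; rewrite (cardsD1 i) (cardsD1 j) !inE nij iP jP uij /=.
  have -> : (P :&: u) :\ i :\ j = (P :\ i :\ j) :&: u.
    by apply/setP => p; rewrite !inE; case: (p == i); case: (p == j).
  by rewrite addnA; case: (j \in u) => /= [[]|[]].
have inner (i j p : pts n) : i \in P -> j \in P -> (i < j)%N ->
    (forall p, p \in P -> ~~ (i < p < j)%N) -> p \in P -> p != i -> p != j ->
    ~~ (i <= p <= j)%N.
  move=> iP jP ij gap pP; have := gap p pP; rewrite -!val_eqE /=.
  by move: ij; clear; lia.
pose Q1 (x : pts n * pts n) := [&& x.1 \in P, x.2 \in P, (x.1 < x.2)%N, x.1 \notin u & x.2 \in u].
have M'P (i j : pts n) M' g' p : pairing_of (P :\ i :\ j) u M' g' ->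
    p \in P :\ i :\ j -> M' p \in P :\ i :\ j.
  by move=> hM pP; rewrite -(pair_supp hM) (pairK hM) eq_sym (pair_supp hM).
have [x0 Q1x0|noQ1] := pickP Q1.
  case: (@arg_minnP _ x0 Q1 (fun x => x.2 - x.1)%N Q1x0) => -[i j].
  move=> /and5P/=[iP jP ij iu ju] imin.
  have gap p : p \in P -> ~~ (i < p < j)%N.
    move=> pP; apply/negP => /andP[ip pj].
    have [pu|pu] := boolP (p \in u).
      by have := imin (i, p); rewrite /Q1 /= iP pP ip iu pu => /(_ isT); lia.
    by have := imin (p, j); rewrite /Q1 /= jP pP pj ju pu => /(_ isT); lia.
  have uij : (i \in u) = (j \notin u) by rewrite ju (negPf iu).
  have [M' [g' hM]] := IH i j iP jP ij uij.
  (* A gap falling under the new arc is moved to [j], just outside it; no other arc ends between [i]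
     and [j]. *)
  pose g := if (i <= g' < j)%N then j else g'.
  have gE : nat_of_ord g = if (i <= g' < j)%N then nat_of_ord j else nat_of_ord g'.
    by rewrite /g; case: ifP.
  have [|p pP lp|M hM'] := pairing_step (g := g) iP jP ij gap uij hM; last by exists M, g.
    by rewrite iu gE; case: ifP; move: ij; clear; lia.
  rewrite gE; apply: hole_shift => //.
    by move: pP; rewrite !inE => /and3P[pj pi pP]; apply: inner.
  have := M'P _ _ _ _ _ hM pP; rewrite !inE => /and3P[pj pi Pp].
  exact: inner.
have before p q : p \in P -> q \in P -> p \in u -> q \notin u -> (p < q)%N.
  move=> pP qP pu qu; have := noQ1 (q, p); rewrite /Q1 /= qP pP pu qu /= andbT => h.
  by have : p != q by [apply: contraNneq qu => <-]; rewrite -val_eqE /=; move: h; clear; lia.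
pose Q2 (x : pts n * pts n) := [&& x.1 \in P, x.2 \in P, x.1 \in u & x.2 \notin u].
have [x0 Q2x0] : exists x, Q2 x.
  have /card_gt0P[i /setIP[iP iu]] : (0 < #|P :&: u|)%N by rewrite cPu.
  have /card_gt0P[j /setDP[jP ju]] : (0 < #|P :\: u|)%N.
    by rewrite cardsD cPu cP; clear; lia.
  by exists (i, j); rewrite /Q2 /= iP jP iu.
case: (@arg_minnP _ x0 Q2 (fun x => x.2 - x.1)%N Q2x0) => -[i j].
move=> /and4P/=[iP jP iu ju] imin.
have ij := before i j iP jP iu ju.
have gap p : p \in P -> ~~ (i < p < j)%N.
  move=> pP; apply/negP => /andP[ip pj].
  have [pu|pu] := boolP (p \in u).
    by have := imin (p, j); rewrite /Q2 /= jP pP ju pu => /(_ isT); lia.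
  by have := imin (i, p); rewrite /Q2 /= iP pP iu pu => /(_ isT); lia.
have uij : (i \in u) = (j \notin u) by rewrite iu ju.
have [M' [g' hM]] := IH i j iP jP ij uij.
(* Every remaining arc runs from a minus before [i] to a plus after [j], so the gap [i] lies under
   all of them. *)
have [|p pP' lp|M hM'] := pairing_step (g := i) iP jP ij gap uij hM; last by exists M, i.
  by rewrite iu leqnn ij.
have := M'P _ _ _ _ _ hM pP'; rewrite !inE => /and3P[Mpj Mpi MpP].
have /and3P[pj pi pP] : [&& p != j, p != i & p \in P] by move: pP'; rewrite !inE.
have Mpu := pair_sign hM pP'; have pu : p \in u.
  apply/negPn/negP => pu; have := before _ _ MpP pP; rewrite Mpu pu => /(_ isT isT).
  by rewrite ltnNge (ltnW lp).
have := pair_hole hM pP' lp; rewrite pu => /esym/negbFE ->.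
have iMp : (i < M' p)%N by apply: before => //; rewrite Mpu pu.
have pltj : (p < j)%N by apply: before.
have := gap p pP; move: pi; rewrite iMp pltj !andbT -leqNgt -val_eqE /=.
by move=> _ ->.
Qed.

(** By [R], a connection prescribes [u] at the left end of each arc and the opposite sign at the
    right end. Hence choosing a connection for every balanced [u] is injective. *)
Lemma card_Mb0 : (0 < n)%N ->
  ('C(n.*2, n) <= #|[pred c : Mb1 n | ~~ (val c).2.1]|)%N.
Proof.
move=> n_gt0.
have g0 : pts n by apply: (@Ordinal _ 0); rewrite double_gt0.
pose R (u : {set pts n}) (c : Mb1 n) :=
  let: (M, (b, g)) := val c in
  ~~ b && [forall p, ((M p \in u) == (p \notin u)) &&
    ((p < M p)%N ==> ((p \notin u) == ~~ (p <= g < M p)%N))].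
have exR u : #|u| == n -> exists c, R u c.
  move=> /eqP cu.
  have [||M [g [MK Ms Mnc Mu Mh]]] := @pairing_exists g0 n setT u.
  - by rewrite cardsT card_ord.
  - by rewrite setTI.
  pose M0 : matching n := finfun M.
  (* The gap is replaced by the smallest one of its face, as [face_rep] demands; the arcs covering
     it stay the same. *)
  case: (@arg_minnP _ g (fun h => same_face M0 g h) (@nat_of_ord _)).
    by apply/forallP => a; rewrite eqxx implybT.
  move=> h gh hmin.
  have v : valid_conn (M0, (false, h)).
    apply/and3P; split.
    - by apply/forallP => p; rewrite !ffunE MK eqxx Ms inE.
    - by apply/forallP => a; apply/forallP => b; rewrite !ffunE Mnc implybT.
    apply/forallP => h'; apply/implyP => hh'; apply/negP => sf.
    have /hmin : same_face M0 g h'; last by rewrite leqNgt hh'.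
    apply/forallP => a; apply/implyP => la.
    have /forallP/(_ a)/implyP/(_ la)/eqP -> := gh.
    exact: (implyP (forallP sf a)).
  exists (exist _ (M0, (false, h)) v); rewrite /R /=; apply/forallP => p.
  rewrite !ffunE Mu ?inE // eqxx /=; apply/implyP => lp; rewrite Mh ?inE //.
  have /forallP/(_ p) := gh; rewrite !ffunE lp /= => /eqP ->.
  by rewrite eqxx.
have Rinj u v c : R u c -> R v c -> u = v.
  case: c => -[M [b g]] val_c; rewrite /R /= => /andP[_ /forallP hu] /andP[_ /forallP hv].
  have key p : (p < M p)%N -> (p \in u) = (p \in v).
    move=> lp; have := hu p; have := hv p; rewrite lp /= => /andP[_ /eqP h1] /andP[_ /eqP h2].
    by apply: negb_inj; rewrite h1 h2.
  move: val_c => /and3P[/forallP hM _ _].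
  apply/setP => p; have /andP[/eqP MK Mn] := hM p.
  case: (ltngtP p (M p)) => [|lt|/val_inj E]; first exact: key.
    have /andP[/eqP hu' _] := hu (M p); have /andP[/eqP hv' _] := hv (M p).
    rewrite MK in hu' hv'; rewrite hu' hv' key // MK //.
  by rewrite -E eqxx in Mn.
(* The value [inr tt] makes [c0] total; it occurs only at unbalanced [u]. *)
pose c0 u : Mb1 n + unit := if @idP (#|u| == n) is ReflectT h then inl (xchoose (exR u h)) else inr tt.
have <- : #|[set u : {set pts n} | #|u| == n]| = 'C(n.*2, n) by rewrite card_draws card_ord.
have c0P u : #|u| == n -> exists2 c, c0 u = inl c & R u c.
  move=> cu; rewrite /c0; case: {-}_ / idP => // h.
  by exists (xchoose (exR u h)) => //; apply: xchooseP.
have c0inj : {in [set u : {set pts n} | #|u| == n] &, injective c0}.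
  move=> u v; rewrite !inE => /c0P[c -> Ru] /c0P[d -> Rv] [E].
  by apply: (Rinj u v c Ru); rewrite E.
rewrite -(card_in_imset c0inj) -(card_imset _ (@inl_inj (Mb1 n) unit)).
apply/subset_leq_card/subsetP => x /imsetP[u]; rewrite inE => /c0P[c E Ru] ->.
rewrite {}E.
apply/imsetP; exists c => //; rewrite inE; move: Ru; rewrite /R.
by case: (val c) => M [b g] /andP[].
Qed.

End Counting.

(** * Orientation states and the raising operator *)

Lemma card_ltn_ord N m : (m <= N)%N -> #|[set p : 'I_N | (p < m)%N]| = m.
Proof.
move=> mN; rewrite -sum1_card (eq_bigl (fun p : 'I_N => (p < m)%N)); last by move=> p; rewrite inE.
by rewrite -(big_ord_widen N (fun=> 1%N)) // sum1_card card_ord.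
Qed.

Lemma card_interval N (a b : 'I_N) : (a < b)%N ->
  #|[set p : 'I_N | (a < p < b)%N]| = (b - a.+1)%N.
Proof.
move=> ab; rewrite -{2}(card_ltn_ord (ltnW (ltn_ord b))) -{2}(card_ltn_ord (ltn_ord a)).
rewrite -cardsDS; last by apply/subsetP => p; rewrite !inE; move: ab; clear; lia.
by apply: eq_card => p; rewrite !inE; move: ab; clear; lia.
Qed.

Section States.
Variables (F : realFieldType) (n : nat) (rho : F).
Hypothesis rho_neq0 : rho != 0.
Local Notation q := (rho ^+ 4).
Implicit Types (M : pts n -> pts n) (T u v : {set pts n}) (p a b g : pts n) (W : F).

Definition pw (x : F) (s : bool) : F := if s then x else x^-1.

Definition compat M u := [forall p, (M p \in u) == (p \notin u)].

(* A state is the set [u] of points crossed downwards.  The factor [rho^(+-1)] is a quarter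
   turn, and the factors [W^(+-1)] multiply to [W] to the winding number around the
   crosscap in gap [g]. *)
Definition point_weight M W g p (s : bool) : F :=
  pw rho (s == (p < M p)%N) * (if (p <= g)%N then pw W s else 1).

Definition weight M W g u : F :=
  if compat M u then \prod_p point_weight M W g p (p \notin u) else 0.

(** The exponent of [q] is the number of minus signs less the number of plus signs of [T] before
    [j], as in the coproduct of a raising operator. *)
Definition raise_coef T (j : nat) : F := (-1) ^+ j * q ^- j * (q ^+ 2) ^+ below T j.

Definition raising T u : F :=
  if T \subset u then \prod_(j in u :\: T) raise_coef T j else 0.

(** Partners carry the points of [I] in [T] to points of [I] outside [T]; what is left are the ends
    of arcs avoiding [T]. *)
Lemma card_double_plus M T (I : {set pts n}) : arcs_on M setT ->
  (forall p, p \in I -> M p \in I) -> (forall p, p \in T -> M p \notin T) ->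
  #|I| = ((#|I :&: T|).*2 + #|I :&: [set p | (p \notin T) && (M p \notin T)]|)%N.
Proof.
move=> hM IM TM; have MK p : M (M p) = p by rewrite (arcsK hM (in_setT p)).
have Minj : injective M by apply: can_inj MK.
rewrite -(cardsID T I) -(addnn #|I :&: T|) -addnA; congr (_ + _)%N.
rewrite -(cardsID [set p | M p \in T] (I :\: T)); congr (_ + _)%N.
  rewrite -(card_imset _ Minj); apply: eq_card => p; rewrite !inE.
  apply/imsetP/idP => [[r]|/andP[pI pT]].
    by rewrite !inE => /andP[/andP[rT rI] MrT] ->; rewrite IM ?MrT.
  by exists (M p); rewrite ?MK // !inE MK pT IM // TM.
by apply: eq_card => p; rewrite !inE; case: (p \in I); case: (p \in T); case: (M p \in T).
Qed.

Lemma below_interval T a b : (a < b)%N -> a \notin T ->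
  below T b = (below T a + #|[set p : pts n | (a < p < b)%N] :&: T|)%N.
Proof.
move=> ab aT; rewrite /below -cardsUI.
rewrite [X in (_ + X)%N](_ : _ = 0%N) ?addn0; last first.
  by apply/eqP; rewrite cards_eq0; apply/eqP/setP => p; rewrite !inE; case: (p \in T); lia.
apply: eq_card => p; rewrite !inE; have [pT|//] := boolP (p \in T); last by rewrite andbF.
have : p != a by apply: contraNneq aT => <-.
by rewrite -val_eqE /=; lia.
Qed.

(* An arc with both ends outside [T] for which moving the added minus sign from one end to
   the other negates the summand: an innermost such arc not covering [g] or, if all of
   them cover [g], the outermost one. *)
Lemma critical_arc M W g T k : arcs_on M setT -> (0 < k)%N -> (#|T| + k)%N = n ->
  (forall p, p \in T -> M p \notin T) -> W ^+ 2 = q ^+ k.-1.*2 ->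
  exists a c, [/\ a \notin T, M a \notin T, (a < M a)%N,
    (M a = a.+1 + (#|[set p : pts n | (a < p < M a)%N] :&: T|).*2 + c.*2 :> nat)%N &
    if (a <= g < M a)%N then W ^+ 2 = q ^+ c.*2 else c = 0%N].
Proof.
move=> hM k_gt0 Tk TM W2.
have MK p : M (M p) = p by rewrite (arcsK hM (in_setT p)).
pose PP := [set p | (p \notin T) && (M p \notin T)].
have cPP : #|PP| = k.*2.
  have := card_double_plus hM (fun p _ => in_setT (M p)) TM.
  by rewrite !setTI cardsT card_ord -/PP; move: Tk; clear; lia.
have PPM p : p \in PP -> M p \in PP by rewrite !inE MK andbC.
have PPmin p : p \in PP -> exists c, [/\ c \in PP, (c < M c)%N & p = c \/ p = M c].
  move=> pP; have [lt|lt|E] := ltngtP p (M p).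
  - by exists p; split=> //; left.
  - by exists (M p); rewrite MK; split=> //; [exact: PPM|right].
  - by have := arcs_neq hM (in_setT p); rewrite -E eqxx.
have len a : (a < M a)%N -> (nat_of_ord (M a) = a.+1 +
    (#|[set p : pts n | (a < p < M a)%N] :&: T|).*2 + #|[set p : pts n | (a < p < M a)%N] :&: PP|)%N.
  move=> la; have := @card_double_plus M T [set p : pts n | (a < p < M a)%N] hM _ TM.
  rewrite card_interval // -/PP => E; rewrite -addnA -E ?subnKC //.
  by move=> p; rewrite !inE => ap; rewrite (arc_inner hM (in_setT a) la (in_setT p)).
have [a0 a0P|allin] := pickP (fun a => [&& a \in PP, (a < M a)%N & ~~ (a <= g < M a)%N]).
  case: (@arg_minnP _ a0 (fun a => [&& a \in PP, (a < M a)%N & ~~ (a <= g < M a)%N]) (fun a => M a - a)%N a0P).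
  move=> a /and3P[aP la ga] amin; exists a, 0%N.
  have /andP[aT MaT] : (a \notin T) && (M a \notin T) by move: aP; rewrite inE.
  split=> //; last by rewrite (negPf ga).
  rewrite [LHS]len // [X in (_ + X = _)%N](_ : _ = 0%N) //.
  apply/eqP; rewrite cards_eq0; apply/eqP/setP => p; rewrite [RHS]inE.
  apply/negP => /setIP[]; rewrite inE => ap pP.
  have aMp := arc_inner hM (in_setT a) la (in_setT p) ap.
  have [c [cP lc pc]] := PPmin p pP.
  have := amin c; rewrite cP lc /=.
  have [ac cb] : (a < c)%N /\ (M c < M a)%N.
    by case: pc ap aMp => ->; rewrite ?MK; clear; lia.
  have -> : ~~ (c <= g < M c)%N by move: ga ac cb lc; clear; lia.
  by move=> /(_ isT); move: ac cb lc; clear; lia.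
have {}allin a : a \in PP -> (a < M a)%N -> (a <= g < M a)%N.
  by move=> aP la; have := allin a; rewrite aP la /= => /negbFE.
have /card_gt0P[p0 /PPmin[a0 [a0P la0 _]]] : (0 < #|PP|)%N by rewrite cPP double_gt0.
(* All arcs in [PP] cover [g], hence are nested, and the longest one has the other [k.-1] under
   it. *)
case: (@arg_maxnP _ a0 (fun a => (a \in PP) && (a < M a)%N) (fun a => M a - a)%N).
  by rewrite a0P.
move=> a /andP[aP la] amax; exists a, k.-1.
have /andP[aT MaT] : (a \notin T) && (M a \notin T) by move: aP; rewrite inE.
split=> //; last by rewrite allin.
rewrite [LHS]len //; congr (_ + _)%N.
have -> : [set p : pts n | (a < p < M a)%N] :&: PP = PP :\ a :\ M a.
  apply/setP => p; rewrite !inE; have [->|pMa] := eqVneq p (M a); first by rewrite ltnn andbF.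
  have [->|pa] := eqVneq p a; first by rewrite ltnn.
  rewrite /=; case: (boolP ((p \notin T) && (M p \notin T))) => [pP|]; last by rewrite !andbF.
  rewrite !andbT; have pP' : p \in PP by rewrite inE.
  have [c [cP lc pc]] := PPmin p pP'.
  have := amax c; rewrite cP lc => /(_ isT) /=.
  have := allin c cP lc; have := allin a aP la.
  have ca : c != a.
    by case: pc => E; apply: contraNneq pa => Ec; rewrite E Ec // in pMa *; rewrite eqxx in pMa.
  have McMa : M c != M a by apply: contraNneq ca => E; rewrite -(MK c) E MK.
  have := arcs_nc hM (in_setT a) (in_setT c); have := arcs_nc hM (in_setT c) (in_setT a).
  move: ca McMa la lc; rewrite -!val_eqE /=.
  by case: pc => ->; clear; lia.
apply/eqP; rewrite -(eqn_add2l 2) -[X in _ == X]doubleS prednK // -cPP.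
rewrite (cardsD1 a PP) aP (cardsD1 (M a) (PP :\ a)) in_setD1 (PPM a aP) andbT.
have -> // : M a != a by rewrite -val_eqE gtn_eqF.
Qed.

(** Exchanging the two ends of the critical arc is an involution on the states that negates every
    summand, so the sum equals its own negative. *)
Lemma raising_kills M W g T k : arcs_on M setT -> (0 < k)%N -> (#|T| + k)%N = n ->
  W ^+ 2 = q ^+ k.-1.*2 ->
  \sum_(u : {set pts n} | #|u| == n) weight M W g u * raising T u = 0.
Proof.
move=> hM k_gt0 Tk W2.
have MK p : M (M p) = p by rewrite (arcsK hM (in_setT p)).
(* A compatible state contains only one end of each arc, so no [u] containing such a [T]
   contributes. *)
have [p0 /andP[pT MpT]|noTT] := pickP (fun p => (p \in T) && (M p \in T)).
  apply: big1 => u _; rewrite /weight /raising.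
  case: ifP => [/forallP/(_ p0)/eqP h|]; last by rewrite mul0r.
  case: ifP => [/subsetP Tu|]; last by rewrite mulr0.
  by move: h; rewrite !Tu.
have {}noTT p : p \in T -> M p \notin T.
  by move=> pT; have := noTT p; rewrite pT /= => ->.
have [a [c [aT bT la bE gc]]] := critical_arc g hM k_gt0 Tk noTT W2.
pose b := M a; rewrite -/b in bT la bE gc.
have Mb : M b = a by rewrite /b MK.
have nab : b != a by rewrite -val_eqE gtn_eqF.
pose f u := weight M W g u * raising T u.
pose phi u : {set pts n} := [set p | tperm a b p \in u].
have phiK : involutive phi by move=> u; apply/setP => p; rewrite !inE tpermK.
have phiM p : M (tperm a b p) = tperm a b (M p).
  have [->|->|/eqP pa /eqP pb] := tpermP a b p; rewrite ?Mb -/b ?tpermL ?tpermR //.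
  rewrite tpermD //; first by apply: contraNneq pb => E; rewrite /b E MK.
  by apply: contraNneq pa => E; rewrite -Mb E MK.
have phic u : compat M (phi u) = compat M u.
  by apply/forallP/forallP => h p; have := h (tperm a b p); rewrite !inE phiM ?tpermK.
have phi_card u : #|phi u| = #|u|.
  rewrite -(card_imset (mem u) (@perm_inj _ (tperm a b))); apply: eq_card => p.
  by rewrite inE -{2}(tpermK a b p) (mem_imset _ _ (@perm_inj _ (tperm a b))).
have key u : compat M u -> a \in u -> f (phi u) = - f u.
  move=> cu au.
  have bu : b \notin u by have /forallP/(_ a)/eqP := cu; rewrite au => /negbT.
  have aphi : a \notin phi u by rewrite inE tpermL.
  have bphi : b \in phi u by rewrite inE tpermR.
  have phiE p : p != a -> p != b -> (p \in phi u) = (p \in u).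
    by move=> pa pb; rewrite inE tpermD // eq_sym.
  rewrite /f /raising.
  have -> : (T \subset phi u) = (T \subset u).
    have phiT p : p \in T -> (p \in phi u) = (p \in u).
      by move=> pT; apply: phiE; apply: contraTneq pT => ->.
    by apply/subsetP/subsetP => h p pT; have := h p pT; rewrite phiT.
  case: ifP => [Tu|_]; last by rewrite !mulr0 oppr0.
  rewrite /weight phic cu.
  rewrite (bigD1 a) //= (bigD1 b) //= [in RHS](bigD1 a) //= [in RHS](bigD1 b) //=.
  have -> : \prod_(p | (p != a) && (p != b)) point_weight M W g p (p \notin phi u) =
            \prod_(p | (p != a) && (p != b)) point_weight M W g p (p \notin u).
    by apply: eq_bigr => p /andP[pa pb]; rewrite phiE.
  set Z := \prod_(p | _) _.
  rewrite (bigD1 b) /=; last by rewrite inE bT.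
  rewrite [in RHS](bigD1 a) /=; last by rewrite inE aT.
  have -> : \prod_(p in phi u :\: T | p != b) raise_coef T p =
            \prod_(p in u :\: T | p != a) raise_coef T p.
    apply: eq_bigl => p; rewrite !inE.
    have [->|pa] := eqVneq p a; first by rewrite tpermL (negPf bu) /= !andbF.
    have [->|pb] := eqVneq p b; first by rewrite (negPf bu) /= !andbF.
    by rewrite tpermD // eq_sym.
  set Y := \prod_(p in _ | _) _.
  (* The exchange multiplies the turning weight by [q], and the winding weight by [W ^+ 2] if the
     arc covers [g]. Both cancel against the ratio of the raising coefficients. *)
  suff E : point_weight M W g a true * point_weight M W g b false * raise_coef T b =
      - (point_weight M W g a false * point_weight M W g b true * raise_coef T a).
    rewrite aphi bphi au bu /=.
    transitivity (point_weight M W g a true * point_weight M W g b false * raise_coef T b * (Z * Y)); first by ring.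
    by rewrite E; ring.
  (* The distance from [a] to [b] is [2t + 2c + 1], and the [t] points of [T] between them give back
     [q ^+ t.*2]. *)
  have -> : raise_coef T b = - (q ^- c.*2.+1 * raise_coef T a).
    rewrite /raise_coef (below_interval la aT); set t := #|_|.
    have -> : nat_of_ord b = (a + (t.*2 + c.*2.+1))%N by rewrite bE -/t; clear; lia.
    have e2 m : (-1) ^+ m.*2 = 1 :> F by rewrite -mul2n exprM sqrrN !expr1n.
    rewrite !exprD [(-1) ^+ _.+1]exprS !e2 !mulr1 mul1r.
    move: (rho ^+ 4) (expf_neq0 4 rho_neq0) => Q Q0.
    rewrite -!exprM !mul2n !invfM; move: (Q ^+ t.*2) (expf_neq0 t.*2 Q0) => x x0.
    transitivity (- ((-1) ^+ a * Q ^- a * Q ^+ (below T a).*2 * Q ^- c.*2.+1 * (x / x))).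
      by ring.
    by rewrite divff //; ring.
  rewrite /point_weight -/b Mb la (ltnNge b a) (ltnW la) /pw /=.
  have W0 : W != 0.
    have : W ^+ 2 != 0 by rewrite W2 !expf_neq0.
    by rewrite expf_eq0.
  move: (raise_coef T a) => Y0; move: gc; case: (leqP a g) => ag; case: (leqP b g) => bg /=.
  - by move=> ->; rewrite double0; field; rewrite W0 rho_neq0.
  - move=> E; have -> : (rho ^+ 4) ^- c.*2.+1 = (rho ^+ 4)^-1 * (W ^+ 2)^-1.
      by rewrite E -invfM -exprS.
    by field; rewrite W0 rho_neq0.
  - by move: la ag bg; clear; lia.
  - by move=> ->; rewrite double0; field; rewrite rho_neq0.
have fphi u : f (phi u) = - f u.
  have [cu|cu] := boolP (compat M u); last first.
    by rewrite /f /weight phic (negPf cu) !mul0r oppr0.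
  have [au|au] := boolP (a \in u); first exact: key.
  have aphi : a \in phi u.
    by have /forallP/(_ a)/eqP := cu; rewrite -/b au inE tpermL.
  by have := key (phi u); rewrite phic phiK => -> //; rewrite opprK.
rewrite -/f; set s := \sum_(u | _) _.
have : s = - s.
  rewrite {1}/s (reindex_inj (inv_inj phiK)) /= -sumrN.
  by apply: eq_big => u; rewrite ?phi_card // => _; rewrite -/(f _) fphi.
by move/eqP; rewrite -addr_eq0 -mulr2n mulrn_eq0 => /eqP.
Qed.

End States.

(** * Pairings as state sums *)

Section Loops.
Variables (n : nat) (M1 M2 : matching n).
Hypotheses (m1 : is_matching M1) (m2 : is_matching M2).
Hypotheses (nc1 : noncrossing M1) (nc2 : noncrossing M2).

Lemma matching_arcs (M : matching n) (S : {set pts n}) : is_matching M -> noncrossing M ->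
  (forall p, p \in S -> M p \in S) -> arcs_on M S.
Proof.
move=> /forallP mM /forallP ncM SM; split=> // [p _|p _|a b _ _].
- by have /andP[/eqP] := mM p.
- by have /andP[_] := mM p.
- apply/negP => /and3P[ab bMa MaMb].
  have /forallP/(_ b)/implyP := ncM a; rewrite (ltn_trans ab bMa) (ltn_trans bMa MaMb).
  by move=> /(_ isT); rewrite ab bMa MaMb.
Qed.

Definition curve_of (p : pts n) := [set u | connect (glue_rel M1 M2) p u].

Lemma glue_csym : connect_sym (glue_rel M1 M2).
Proof.
apply: sym_connect_sym => u v; rewrite /glue_rel.
have MK (M : matching n) w : is_matching M -> M (M w) = w.
  by move=> /forallP/(_ w)/andP[/eqP].
by apply/orP/orP => -[]/eqP <-; rewrite ?MK // eqxx; [left|right|left|right].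
Qed.

Lemma mem_curve_of p v : (v \in curve_of p) = (curve_of v == curve_of p).
Proof.
rewrite inE; apply/idP/eqP => [pv|E].
  by apply/setP => u; rewrite !inE -(same_connect glue_csym pv).
have : v \in curve_of v by rewrite inE connect0.
by rewrite E inE.
Qed.

Lemma curve_of1 p : curve_of (M1 p) = curve_of p.
Proof.
by apply/eqP; rewrite -mem_curve_of inE connect1 // /glue_rel eqxx.
Qed.

Lemma curve_of2 p : curve_of (M2 p) = curve_of p.
Proof.
by apply/eqP; rewrite -mem_curve_of inE connect1 // /glue_rel eqxx orbT.
Qed.

Lemma curves_of p : curve_of p \in curves M1 M2.
Proof. exact: imset_f. Qed.

Lemma mem_curves S p : S \in curves M1 M2 -> (p \in S) = (curve_of p == S).
Proof. by case/imsetP => v _ ->; rewrite -/(curve_of v) mem_curve_of. Qed.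

Lemma curves_arcs1 S : S \in curves M1 M2 -> arcs_on M1 S.
Proof.
by move=> SC; apply: matching_arcs => // p; rewrite !(mem_curves _ SC) curve_of1.
Qed.

Lemma curves_arcs2 S : S \in curves M1 M2 -> arcs_on M2 S.
Proof.
by move=> SC; apply: matching_arcs => // p; rewrite !(mem_curves _ SC) curve_of2.
Qed.

Lemma curve_invariant (P : pred (pts n)) S : S \in curves M1 M2 ->
  (forall p, p \in S -> P p -> P (M1 p)) -> (forall p, p \in S -> P p -> P (M2 p)) ->
  forall u v, u \in S -> v \in S -> P u -> P v.
Proof.
move=> SC P1 P2 u v uS vS Pu.
have /connectP[s] : connect (glue_rel M1 M2) u v.
  by move: vS; rewrite (mem_curves v SC); move: uS; rewrite (mem_curves u SC) => /eqP<-;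
     rewrite -mem_curve_of inE.
elim: s u uS Pu => [|w s IHs] u uS Pu /=; first by move=> _ ->.
move=> /andP[uw ws] Ev; apply: IHs Ev => //; move: uw => /orP[]/eqP <-.
- exact: (arcs_in (curves_arcs1 SC)).
- exact: (arcs_in (curves_arcs2 SC)).
- exact: P1.
- exact: P2.
Qed.

Lemma curves_loop S : S \in curves M1 M2 -> loop M1 M2 S.
Proof.
move=> SC T TS /set0Pn[x xT] T1 T2; apply/eqP; rewrite eqEsubset TS /=.
apply/subsetP => v vS.
have xS := subsetP TS x xT.
exact: (@curve_invariant (mem T) S SC (fun p _ => T1 p) (fun p _ => T2 p) x v xS vS xT).
Qed.

Lemma curves_neq0 S : S \in curves M1 M2 -> S != set0.
Proof.
case/imsetP => v _ ->; apply/set0Pn; exists v; by rewrite inE connect0.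
Qed.

(** * Orientation states of the glued curves *)

Section StateSum.
Variables (F : realFieldType) (rho t : F).
Hypotheses (rho_neq0 : rho != 0) (t_neq0 : t != 0).
Local Notation q := (rho ^+ 4).

Lemma pwV (x : F) s : pw x (~~ s) = (pw x s)^-1.
Proof. by case: s; rewrite /pw /= ?invrK. Qed.

(** Successive points of [S] contribute inverse factors, which cancel in pairs. *)
Lemma alternating_product (W : F) (S : {set pts n}) (s : bool) (m : nat) : W != 0 -> (m <= n.*2)%N ->
  \prod_(p in S | (p < m)%N) pw W (side S p == s) =
  if odd #|[set u in S | (u < m)%N]| then pw W s else 1.
Proof.
move=> W0; elim: m => [|m IHm] mN.
  rewrite big_pred0 => [|p]; last by rewrite andbF.
  rewrite [X in #|pred_of_set X|](_ : _ = set0) ?cards0 //.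
  by apply/setP => p; rewrite !inE andbF.
pose o : pts n := Ordinal mN.
have pw0 b : pw W b != 0 by case: b; rewrite /pw ?invr_eq0.
have [oS|oS] := boolP (o \in S); last first.
  have E (p : pts n) : (p \in S) && (p < m.+1)%N = (p \in S) && (p < m)%N.
    have [pS|//] := boolP (p \in S); rewrite ltnS leq_eqVlt.
    have -> // : (p == m :> nat) = false.
    by apply/eqP => pm; move: oS; rewrite (_ : o = p) ?pS //; apply: val_inj.
  rewrite (eq_bigl _ _ E) IHm; last exact: ltnW.
  by congr (if odd _ then _ else _); apply: eq_card => p; rewrite !inE E.
have cE : #|[set u in S | (u < m.+1)%N]| = #|[set u in S | (u < m)%N]|.+1.
  rewrite (cardsD1 o) !inE oS /= ltnSn add1n; congr _.+1; apply: eq_card => p.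
  by rewrite !inE -val_eqE /=; case: (p \in S); lia.
rewrite (bigD1 o) /=; last by rewrite oS ltnSn.
rewrite (eq_bigl (fun p : pts n => (p \in S) && (p < m)%N)); last first.
  by move=> p; rewrite -val_eqE /=; case: (p \in S) => //=; lia.
rewrite IHm; last exact: ltnW.
have -> : side S o = odd #|[set u in S | (u < m.+1)%N]| by [].
rewrite cE /=; case: (odd _) => /=; last by rewrite mulr1.
by rewrite pwV mulVf.
Qed.

Lemma alternating_product_gap (W : F) (S : {set pts n}) (s : bool) (g : pts n) : W != 0 ->
  \prod_(p in S) (if (p <= g)%N then pw W (side S p == s) else 1) =
  if side S g then pw W s else 1.
Proof. by move=> W0; rewrite -big_mkcondr; exact: (alternating_product _ _ W0 (ltn_ord g)). Qed.

(** The exponents of [rho] add up to the rotation sum 4, with the sign given by [s]. *)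
Lemma rotation_product S (s : bool) : S \in curves M1 M2 ->
  \prod_(p in S) (pw rho ((side S p == s) == (p < M1 p)%N) *
                  pw rho ((side S p == s) == (p < M2 p)%N)) = pw q s.
Proof.
move=> SC.
have pwE b : pw rho b = rho ^ (if b then 1 else -1 : int) by case: b.
pose e : int := if s then 1 else -1.
transitivity (rho ^ (\sum_(p in S) e * (eps S p * (tau M1 p + tau M2 p)))).
  rewrite (big_morph (fun x : int => rho ^ x) (id1 := 1) (op1 := *%R)).
  - apply: eq_bigr => p _; rewrite !pwE -expfzDr //; congr (_ ^ _).
    by rewrite /e /eps /tau; clear e; case: s; case: (side S p); case: (p < M1 p)%N; case: (p < M2 p)%N.
  - by move=> x y; rewrite expfzDr.
  - by rewrite expr0z.
rewrite -mulr_sumr (loop_rotation (curves_arcs1 SC) (curves_arcs2 SC) (curves_neq0 SC) (curves_loop SC)).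
by rewrite /e; clear e; case: s; rewrite /pw.
Qed.

(* For [W1 = t / q] and [W2 = (t q)^-1], turning and winding combine to the weight of a
   curve in the annulus between the two crosscaps. *)
Lemma loop_weight S g1 g2 (s : bool) : S \in curves M1 M2 ->
  \prod_(p in S) (point_weight rho M1 (t / q) g1 p (side S p == s) *
                  point_weight rho M2 (t * q)^-1 g2 p (side S p == s)) =
  pw (if side S g1 then (if side S g2 then q^-1 else t)
      else (if side S g2 then t^-1 else q)) s.
Proof.
move=> SC; have q0 : q != 0 by rewrite expf_neq0.
have W0 : t / q != 0 by rewrite mulf_neq0 ?invr_neq0.
have W'0 : (t * q)^-1 != 0 by rewrite invr_neq0 ?mulf_neq0.
transitivity ((\prod_(p in S) (pw rho ((side S p == s) == (p < M1 p)%N) *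
                  pw rho ((side S p == s) == (p < M2 p)%N))) *
  (\prod_(p in S) (if (p <= g1)%N then pw (t / q) (side S p == s) else 1) *
   \prod_(p in S) (if (p <= g2)%N then pw (t * q)^-1 (side S p == s) else 1))).
  by rewrite -!big_split; apply: eq_bigr => p _; rewrite /point_weight /=; ring.
rewrite rotation_product // !alternating_product_gap //.
by case: (side S g1); case: (side S g2); case: s; rewrite /pw; field; rewrite ?rho_neq0 ?t_neq0.
Qed.

(** Along each arc both membership in [u] and the side switch, so their agreement spreads over the
    whole curve. *)
Lemma compat_const u S : compat M1 u -> compat M2 u -> S \in curves M1 M2 ->
  forall p r, p \in S -> r \in S ->
  ((p \notin u) == side S p) = ((r \notin u) == side S r).
Proof.
move=> /forallP c1 /forallP c2 SC p r pS rS.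
apply/idP/idP; apply: (@curve_invariant (fun p => (p \notin u) == side S p) S SC) => // v vS.
all: rewrite ?(side_arc (curves_arcs1 SC) vS) ?(side_arc (curves_arcs2 SC) vS).
all: rewrite ?(eqP (c1 v)) ?(eqP (c2 v)) negbK => /eqP <-.
all: by rewrite negbK.
Qed.

(* The orientations of a curve [S] are the two alternating ones, [side S p == s]. *)
Lemma state_sum g1 g2 :
  \sum_(u : {set pts n}) weight rho M1 (t / q) g1 u * weight rho M2 (t * q)^-1 g2 u =
  \prod_(S in curves M1 M2) (if side S g1 != side S g2 then t + t^-1 else q + q^-1).
Proof.
pose pp p s := point_weight rho M1 (t / q) g1 p s * point_weight rho M2 (t * q)^-1 g2 p s.
transitivity (\prod_(S in curves M1 M2) \sum_(s : bool) \prod_(p in S) pp p (side S p == s)); last first.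
  apply: eq_bigr => S SC; rewrite big_bool /= !loop_weight //.
  by case: (side S g1); case: (side S g2); rewrite /pw ?invrK //= addrC.
(* A choice of orientations is a function with default [false] off [curves M1 M2]; [h] and [h']
   translate between these functions and the compatible states. *)
rewrite (big_distr_big false) /=.
transitivity (\sum_(u | compat M1 u && compat M2 u) \prod_p pp p (p \notin u)).
  rewrite [RHS]big_mkcond; apply: eq_bigr => u _; rewrite /weight.
  case: ifP => _ /=; last by rewrite mul0r.
  by case: ifP => _; rewrite ?mulr0 // -big_split.
pose h (f : {ffun {set pts n} -> bool}) : {set pts n} :=
  [set p | ~~ (side (curve_of p) p == f (curve_of p))].
pose h' (u : {set pts n}) : {ffun {set pts n} -> bool} :=
  [ffun S => (S \in curves M1 M2) && [exists p, (p \in S) && ((p \notin u) == side S p)]].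
have mem_own p : p \in curve_of p by rewrite inE connect0.
have h'E u p : compat M1 u -> compat M2 u -> h' u (curve_of p) = ((p \notin u) == side (curve_of p) p).
  move=> c1 c2; rewrite ffunE curves_of /=; apply/existsP/idP => [[r /andP[rS]]|e].
    by rewrite (compat_const c1 c2 (curves_of p) rS (mem_own p)).
  by exists p; rewrite mem_own.
rewrite (reindex_onto h h') /=; last first.
  move=> u /andP[c1 c2]; apply/setP => p; rewrite inE h'E //.
  by case: (p \in u); case: (side _ _).
apply: eq_big => [f|f _].
  apply/andP/familyP => [[/andP[c1 c2] /eqP fE] S|ff].
    rewrite -fE ffunE; by case: (boolP (S \in curves M1 M2)) => SC /=; rewrite ?inE.
  split.
    apply/andP; split; apply/forallP => p; rewrite !inE ?curve_of1 ?curve_of2.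
      rewrite (side_arc (curves_arcs1 (curves_of p)) (mem_own p)).
      by case: (side _ _); case: (f _).
    rewrite (side_arc (curves_arcs2 (curves_of p)) (mem_own p)).
    by case: (side _ _); case: (f _).
  apply/eqP/ffunP => S; rewrite ffunE; have := ff S.
  case: (boolP (S \in curves M1 M2)) => SC /=; last first.
    by rewrite inE => /eqP ->.
  move=> _; apply/existsP/idP => [[p]|fS].
    rewrite (mem_curves p SC) => /andP[/eqP <-]; rewrite inE negbK.
    by case: (side _ _); case: (f _).
  have /set0Pn[p pS] := curves_neq0 SC; exists p; rewrite pS inE negbK.
  by move: pS; rewrite (mem_curves p SC) => /eqP ->; rewrite fS; case: (side _ _).
rewrite (partition_big curve_of (fun S => S \in curves M1 M2)) /=; last by move=> p _; apply: curves_of.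
apply: eq_bigr => S SC; apply: eq_big => [p|p /eqP <-]; first by rewrite (mem_curves p SC).
by rewrite inE negbK.
Qed.

Lemma pairing_disk (ev : {rmorphism Pol -> F}) g1 g2 :
  ev vd = q + q^-1 -> ev vz = t + t^-1 ->
  ev (pairing (M1, (false, g1)) (M2, (false, g2))) =
  \sum_(u : {set pts n} | #|u| == n)
     weight rho M1 (t / q) g1 u * weight rho M2 (t * q)^-1 g2 u.
Proof.
move=> evd evz; transitivity (\sum_(u : {set pts n})
     weight rho M1 (t / q) g1 u * weight rho M2 (t * q)^-1 g2 u).
  rewrite state_sum rmorph_prod; apply: eq_bigr => S _ /=.
  by case: ifP; rewrite ?evd ?evz.
(* [M1] exchanges a compatible [u] with its complement, so unbalanced states have weight 0. *)
rewrite [RHS]big_mkcond; apply: eq_bigr => u _; case: ifP => // cu.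
rewrite /weight; case: ifP => c; last by rewrite mul0r.
case/negP: (negbT cu).
have MK p : M1 (M1 p) = p by have /forallP/(_ p)/andP[/eqP] := m1.
have e : #|u| = #|~: u|.
  rewrite -(card_imset u (can_inj MK)); apply: eq_card => p; rewrite !inE.
  apply/imsetP/idP => [[r ru ->]|pu]; have /forallP cf := c.
    by rewrite (eqP (cf r)) ru.
  by exists (M1 p); rewrite ?MK // (eqP (cf p)).
by have := cardsC u; rewrite -e card_ord addnn => /eqP; rewrite (inj_eq double_inj).
Qed.

End StateSum.

(** Only the curve through [g2] changes: it has class [vy] on the left, and classes [vd] and [vz] in
    some order on the right, as its sides at [g2] and [M2 g2] differ. Any other curve has both
    points on the same side. *)
Lemma pairing_crosscap g1 g2 :
  (vd + vz) * pairing (M1, (false, g1)) (M2, (true, g2)) =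
  vy * (pairing (M1, (false, g1)) (M2, (false, g2)) +
        pairing (M1, (false, g1)) (M2, (false, M2 g2))).
Proof.
have mem_own p : p \in curve_of p by rewrite inE connect0.
rewrite /pairing /=.
rewrite 3!(bigD1 (curve_of g2) (curves_of g2)) /=.
set X := \prod_(S | _) _; set Y := \prod_(S | _) _; set Z := \prod_(S | _) _.
have g2N S : S \in curves M1 M2 -> S != curve_of g2 -> g2 \notin S.
  by move=> SC; apply: contraNN; rewrite (mem_curves _ SC) eq_sym.
have -> : Y = X by apply: eq_bigr => S /andP[SC SN] /=; rewrite (negPf (g2N S SC SN)).
have -> : Z = X.
  apply: eq_bigr => S /andP[SC SN] /=; rewrite (negPf (g2N S SC SN)) /=.
  rewrite (side_arc_outside _ (curves_arcs2 SC) (g2N S SC SN)) //.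
  by apply: matching_arcs => // p; rewrite !inE.
rewrite mem_own (side_arc (curves_arcs2 (curves_of g2)) (mem_own g2)).
by case: (side _ g1); case: (side _ g2) => /=; ring.
Qed.

End Loops.

(** * The rank of the specialised Gram matrix *)

Lemma chebT_morph (A B : pzRingType) (f : {rmorphism A -> B}) (x : A) k :
  f (chebT x k) = chebT (f x) k.
Proof.
rewrite /chebT.
have -> : chebT_aux (f x) k = (f (chebT_aux x k).1, f (chebT_aux x k).2); last by [].
elim: k => [|k /= ->]; first by rewrite /= rmorph_nat.
by case: (chebT_aux x k) => a b /=; rewrite rmorphB rmorphM.
Qed.

Lemma chebT_sum (F : fieldType) (q : F) k : q != 0 -> chebT (q + q^-1) k = q ^+ k + q ^- k.
Proof.
move=> q0; rewrite /chebT.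
suff -> : chebT_aux (q + q^-1) k = (q ^+ k + q ^- k, q ^+ k.+1 + q ^- k.+1) by [].
elim: k => [|k /= ->]; first by rewrite /= expr0 invr1 expr1 -natr1.
congr (_, _); rewrite !exprS; field.
by rewrite q0 expf_neq0.
Qed.

Section RankBound.
Variables (F : realFieldType) (n k : nat) (rho : F) (ev : {rmorphism Pol -> F}).
Local Notation q := (rho ^+ 4).
Local Notation t := ((-1) ^+ k.+1 * q ^+ k).
Hypotheses (rho_gt1 : 1 < rho) (k_gt0 : (0 < k)%N) (k_len : (k <= n)%N).
Hypotheses (evd : ev vd = q + q^-1) (evz : ev vz = t + t^-1).

(** Rescaling by [D] turns the raising matrix into the weighted inclusion matrix with
    [p = q ^+ 2]. *)
Lemma raising_free (f : {set pts n} -> F) :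
  (forall u : {set pts n}, #|u| = n ->
     \sum_(T : {set pts n} | #|T| == (n - k)%N) f T * raising rho T u = 0) ->
  forall T : {set pts n}, #|T| = (n - k)%N -> f T = 0.
Proof.
move=> hf T cT.
have rho0 : rho != 0 by rewrite gt_eqF // (lt_trans ltr01).
have q0 : q != 0 by rewrite expf_neq0.
pose D (S : {set pts n}) : F := \prod_(j in S) ((-1) ^+ j * q ^- j).
have D0 S : D S != 0.
  by apply/prodf_neq0 => j _; rewrite mulf_neq0 ?invr_neq0 ?expf_neq0 // oppr_eq0 oner_eq0.
have DT : D T * (f T / D T) = f T by rewrite mulrC divfK.
rewrite -DT (@weighted_inclusion_inj F n.*2 (q ^+ 2) _ n.*2 (n - k) n (fun T => f T / D T)) //.
- by rewrite mulr0.
- by rewrite !exprn_gt0 // (lt_trans ltr01).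
- by rewrite leq_subr.
- by rewrite -addnn leq_add2r leq_subr.
move=> u _ cu; apply: (mulfI (D0 u)); rewrite mulr0 -[RHS](hf u cu) mulr_sumr.
rewrite [in RHS](eq_bigl (fun T : {set pts n} => #|T| == (n - k)%N)) //.
rewrite big_mkcondl; apply: eq_bigr => U _; rewrite /raising; case: ifP => Uu; last by rewrite mulr0.
have -> : D u = D U * D (u :\: U).
  by rewrite /D (big_setID U) /= (setIidPr Uu).
rewrite /raise_coef big_split /= -/(D _) /inversions expr_sum.
by field; rewrite D0.
Qed.

(** For odd [k] both terms are positive. For even [k], hence [k > 1], the sum is negative because
    [q + q^-1] is smaller than [q ^+ k + q ^- k]. *)
Lemma dz_neq0 : ev vd + ev vz != 0.
Proof.
have q1 : 1 < q by rewrite exprn_egt1.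
have q0 : 0 < q by apply: lt_trans q1.
rewrite evd evz; move: q1 q0; move: (rho ^+ 4) => Q q1 q0.
have A0 : 0 < Q + Q^-1 by rewrite addr_gt0 ?invr_gt0.
have Q0 : Q != 0 by rewrite gt_eqF.
have Qk0 : 0 < Q ^+ k by rewrite exprn_gt0.
rewrite invfM -signr_odd /=; case: (boolP (odd k)) => ok /=.
  by rewrite expr0 invr1 !mul1r gt_eqF // addr_gt0 // addr_gt0 ?invr_gt0.
have k1 : (1 < k)%N by case: k k_gt0 ok => [|[]].
have Qk : Q < Q ^+ k by rewrite -{1}(expr1 Q) ltr_eXn2l.
have QQk : 1 < Q * Q ^+ k by rewrite -exprS exprn_egt1.
rewrite expr1 invrN invr1 !mulN1r lt_eqF //.
have -> : Q + Q^-1 + (- Q ^+ k - (Q ^+ k)^-1) = - ((Q ^+ k - Q) * (1 - (Q * Q ^+ k)^-1)).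
  by field; rewrite Q0 gt_eqF.
rewrite oppr_lt0 mulr_gt0 ?subr_gt0 // invf_lt1 // (lt_trans ltr01) //.
Qed.

Lemma Gram_rank : (\rank (map_mx ev (Gram n)) + 'C(n.*2, n - k) <= #|{: Mb1 n}|)%N.
Proof.
have rho0 : rho != 0 by rewrite gt_eqF // (lt_trans ltr01).
have q0 : q != 0 by rewrite expf_neq0.
have t0 : t != 0 by rewrite mulf_neq0 ?expf_neq0 // oppr_eq0 oner_eq0.
have W2 : (t / q) ^+ 2 = q ^+ k.-1.*2.
  rewrite !exprMn -exprM mulnC exprM sqrrN !expr1n mul1r -exprM muln2.
  case: k k_gt0 => // m _; rewrite doubleS /= !exprS exprVn.
  by field; rewrite rho0.
(* The middle index set is the disjoint union of the balanced states and a copy of [Mb_{n,1}]. Rows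
   of [Mb_{n,1}] pass through the copy unchanged, and the kernel vectors [X] vanish there. *)
pose L (c : Mb1 n) (x : {set pts n} + Mb1 n) : F :=
  match x with
  | inl u => if (val c).2.1 then 0 else weight rho (val c).1 (t / q) (val c).2.2 u
  | inr c' => ((val c).2.1 && (c == c'))%:R
  end.
pose R (x : {set pts n} + Mb1 n) (c : Mb1 n) : F :=
  match x with
  | inl u => if (val c).2.1 then ev vy / (ev vd + ev vz) *
       (weight rho (val c).1 (t * q)^-1 (val c).2.2 u +
        weight rho (val c).1 (t * q)^-1 ((val c).1 (val c).2.2) u)
       else weight rho (val c).1 (t * q)^-1 (val c).2.2 u
  | inr c' => ev (pairing (val c') (val c))
  end.
pose X (T : {set pts n}) (x : {set pts n} + Mb1 n) : F :=
  if x is inl u then raising rho T u else 0.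
pose PU := [pred x : {set pts n} + Mb1 n |
   match x with inl u => #|u| == n | inr c => (val c).2.1 end].
pose PW := [pred T : {set pts n} | #|T| == (n - k)%N].
have cPW : #|PW| = 'C(n.*2, n - k).
  have := card_draws (pts n) (n - k)%N; rewrite card_ord => <-.
  by apply: eq_card => T; rewrite !inE.
rewrite -cPW; apply: (@rank_factor_le F (Mb1 n) _ _ PU PW _ L R X).
- move=> i j; rewrite !mxE; move: (enum_val i) (enum_val j) => c1 c2.
  rewrite big_sumType /=.
  case: c1 => -[M1 [b1 g1]] v1; case: c2 => -[M2 [b2 g2]] v2 /=.
  have /and3P[m1 nc1 _] := v1; have /and3P[m2 nc2 _] := v2.
  case: b1 v1 => v1 /=.
    rewrite big1 ?add0r => [|u _]; last by rewrite mul0r.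
    rewrite (bigD1 (exist _ (M1, (true, g1)) v1)) //= eqxx mul1r big1 ?addr0 // => c.
    by rewrite eq_sym => /andP[_ /negPf ->]; rewrite mul0r.
  rewrite [X in _ + X]big1 ?addr0 => [|c _]; last by rewrite mul0r.
  case: b2 v2 => v2; last exact: pairing_disk.
  apply: (mulfI dz_neq0); rewrite -rmorphD -rmorphM pairing_crosscap //.
  rewrite rmorphM !rmorphD !(pairing_disk m1 m2 nc1 nc2 rho0 t0 _ _ evd evz).
  rewrite -big_split !mulr_sumr; apply: eq_bigr => u _ /=.
  by field; exact: dz_neq0.
- move=> c T PT; rewrite big_sumType /= [X in _ + X]big1 ?addr0 => [|u _]; last by rewrite mulr0.
  case: c => -[M [b g]] v /=; have /and3P[m nc _] := v.
  case: b v => v /=; first by rewrite big1 // => u _; rewrite mul0r.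
  apply: (raising_kills rho0 g _ k_gt0 _ W2).
    by apply: matching_arcs => // p; rewrite !inE.
  by move: PT; rewrite inE => /eqP ->; rewrite subnK.
- move=> f hf T; rewrite inE => /eqP; apply: raising_free => u cu.
  by apply: (hf (inl u)); rewrite inE cu eqxx.
(* The middle dimension is at most the size of the Gram matrix because [Mb_{n,0}] has at least as
   many elements as there are balanced states. *)
rewrite -(cardC [pred c : Mb1 n | ~~ (val c).2.1]).
have -> : #|PU| = ('C(n.*2, n) + #|[predC [pred c : Mb1 n | ~~ (val c).2.1]]|)%N.
  rewrite -sum1_card big_sumType /= !sum1_card; congr (_ + _)%N.
    have := card_draws (pts n) n; rewrite card_ord => <-.
    by apply: eq_card => T; rewrite !inE.
  by apply: eq_card => c; rewrite !inE negbK.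
by rewrite leq_add2r; apply: card_Mb0 (leq_trans k_gt0 k_len).
Qed.

End RankBound.

(** * Divisibility with every variable except z specialised *)

Section UnivariateDivisibility.
Variables (F : realFieldType) (n : nat) (rho : F) (phi : {rmorphism Pol -> {poly F}}).
Local Notation q := (rho ^+ 4).
Hypotheses (rho_gt1 : 1 < rho).
Hypotheses (phid : phi vd = (q + q^-1)%:P) (phiz : phi vz = 'X).

Definition zroot k : F := (-1) ^+ k.+1 * (q ^+ k + q ^- k).

(** The function [x + x^-1] is injective for [x >= 1]; it is applied to the powers of [q] after
    taking absolute values. *)
Lemma zroot_inj i j : zroot i = zroot j -> i = j.
Proof.
have q1 : 1 < q by rewrite exprn_egt1.
have q0 : 0 < q by apply: lt_trans q1.
move=> /(congr1 Num.norm); rewrite /zroot !normrM !normrX !normrN1 !expr1n !mul1r.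
rewrite !ger0_norm ?addr_ge0 ?invr_ge0 ?exprn_ge0 ?(ltW (lt_trans ltr01 rho_gt1)) //.
wlog ij : i j / (i <= j)%N => [hw|].
  by case: (leqP i j) => [/hw//|/ltnW/hw h /esym /h].
rewrite -(subnKC ij); move: (j - i)%N => m {ij}.
case: m => [|m]; first by rewrite addn0.
move: q1 q0; move: (rho ^+ 4) => Q q1 q0 E; exfalso.
have Q0 : Q != 0 by rewrite gt_eqF.
have Qm : 1 < Q ^+ m.+1 by rewrite exprn_egt1.
have Qi : 1 <= Q ^+ i by rewrite exprn_ege1 // ltW.
move: E; rewrite exprD; set x := Q ^+ i; set y := Q ^+ m.+1 => E.
have x0 : x != 0 by rewrite expf_neq0.
have y0 : y != 0 by rewrite expf_neq0.
have : (y - 1) * (x * x * y - 1) = 0.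
  have -> : (y - 1) * (x * x * y - 1) = (x * y + (x * y)^-1 - (x + x^-1)) * (x * y).
    by field; rewrite x0 y0.
  by rewrite E subrr mul0r.
move/eqP; rewrite mulf_eq0 subr_eq0 (gt_eqF Qm) /= subr_eq0 gt_eqF //.
apply: (lt_le_trans Qm); rewrite ler_peMl ?(ltW (lt_trans ltr01 Qm)) //.
by rewrite mulr_ege1.
Qed.

Lemma phi_factor k :
  phi (chebT vd k + (-1) ^+ k * vz) = (-1) ^+ k * ('X - (zroot k)%:P).
Proof.
have rho0 : rho != 0 by rewrite gt_eqF // (lt_trans ltr01).
have q0 : q != 0 by rewrite expf_neq0.
rewrite rmorphD rmorphM rmorphXn rmorphN1 phiz chebT_morph phid -chebT_morph chebT_sum //.
rewrite /zroot mulrBr addrC; congr (_ + _).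
rewrite [(-1) ^+ k.+1]exprS -mulrA mulN1r polyCN mulrN opprK polyCM polyC_exp polyCN.
by rewrite mulrA -exprMn mulrNN mulr1 expr1n mul1r.
Qed.

(** The factors have distinct roots, so their powers are coprime and each can be treated alone by
    the corank at its root. *)
Lemma phi_Gram_dvd :
  \prod_(1 <= k < n.+1) phi (chebT vd k + (-1) ^+ k * vz) ^+ 'C(n.*2, n - k) %| phi (GramDet n).
Proof.
apply: prod_dvdp_coprime => [|i j _ _ ij|k].
- exact: iota_uniq.
- apply/coprimep_expl/coprimep_expr; rewrite !phi_factor.
  have cs (b : nat) (x y : {poly F}) : coprimep x y -> coprimep ((-1) ^+ b * x) y.
    by rewrite -signr_odd; case: (odd b); rewrite ?mulN1r ?mul1r // -scaleN1r coprimepZl // oppr_eq0 oner_eq0.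
  apply/cs; rewrite coprimep_sym; apply/cs; rewrite coprimep_XsubC root_XsubC.
  by apply: contra_neq ij => /zroot_inj.
rewrite mem_index_iota ltnS => /andP[k_gt0 k_len]; rewrite phi_factor.
have -> : ((-1) ^+ k * ('X - (zroot k)%:P)) ^+ 'C(n.*2, n - k) =
   (-1) ^+ (k * 'C(n.*2, n - k)) * ('X - (zroot k)%:P) ^+ 'C(n.*2, n - k).
  by rewrite exprMn -exprM.
rewrite -signr_odd mulr_sign; set Y := (_ ^+ _) in |- *.
have : Y %| phi (GramDet n); last by case: ifP; rewrite ?dvdpNl.
rewrite /GramDet -det_map_mx; apply: det_dvdp_rank; rewrite -map_mx_comp.
have rho0 : rho != 0 by rewrite gt_eqF // (lt_trans ltr01).
have q0 : q != 0 by rewrite expf_neq0.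
apply: (@Gram_rank F n k rho (horner_eval (zroot k) \o phi)) => //=.
  by rewrite phid /horner_eval hornerC.
rewrite phiz /horner_eval hornerX /zroot mulrDr invfM; congr (_ + _ * _).
by rewrite -signr_odd; case: (odd _); rewrite ?invrN invr1.
Qed.

End UnivariateDivisibility.

(** * Lifting to integer polynomials *)

Lemma digits_inj (D m : nat) (f g : 'I_m -> nat) :
  (forall i, (f i < D)%N) -> (forall i, (g i < D)%N) ->
  (\sum_(i < m) f i * D ^ i = \sum_(i < m) g i * D ^ i)%N -> f =1 g.
Proof.
elim: m f g => [|m IHm] f g fD gD; first by move=> _ [].
have D_gt0 : (0 < D)%N by apply: leq_ltn_trans (fD ord0).
have shift (h : 'I_m.+1 -> nat) : (\sum_(i < m.+1) h i * D ^ i =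
    (\sum_(i < m) h (lift ord0 i) * D ^ i) * D + h ord0)%N.
  rewrite big_ord_recl /= expn0 muln1 addnC; congr (_ + _)%N.
  by rewrite big_distrl; apply: eq_bigr => i _ /=; rewrite /bump /= add1n expnSr mulnA.
rewrite !shift => E i.
have E0 : f ord0 = g ord0.
  by have := congr1 (modn^~ D) E; rewrite !modnMDl !modn_small.
have [j ->|->] := unliftP ord0 i; last exact: E0.
apply: (IHm (fun j => f (lift ord0 j)) (fun j => g (lift ord0 j))) => // {i j}.
by move/eqP: E; rewrite E0 eqn_add2r eqn_pmul2r // => /eqP.
Qed.

(* Kronecker substitution 'X_i := X ^ (D ^ i) with D exceeding the degree. *)
Lemma mpoly_int_eq0 (F : realFieldType) (m : nat) (e : nat -> F) (p : {mpoly int[m]}) :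
  injective e ->
  (forall k D, mmap intr (fun i => e k ^+ (D ^ i)) p = 0) -> p = 0.
Proof.
move=> einj pe; apply/eqP/negPn/negP => p0.
pose D := msize p.
pose K (x : 'X_{1..m}) := (\sum_(i < m) x i * D ^ i)%N.
pose P : {poly F} := \sum_(x <- msupp p) (p@_x)%:~R *: 'X^(K x).
have Pe k : P.[e k] = 0.
  rewrite -(pe k D) /P horner_sum; apply: eq_bigr => x _.
  rewrite hornerZ hornerXn /mmap1 /K expr_sum; congr (_ * _).
  by apply: eq_bigr => i _; rewrite mulnC exprM.
have P0 : P = 0.
  apply/eqP/negPn/negP => P0.
  have := @max_poly_roots _ P [seq e i | i <- iota 0 (size P)] P0.
  rewrite size_map size_iota ltnn => absurd; have : false; last by []; apply: absurd.
    by apply/allP => _ /mapP[i _ ->]; rewrite rootE Pe.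
  by rewrite map_inj_uniq ?iota_uniq.
have [x xp] : exists x, x \in msupp p.
  by exists (mlead p); rewrite mlead_supp.
have ltD y (i : 'I_m) : y \in msupp p -> (y i < D)%N.
  by move=> /msize_mdeg_lt; apply: leq_ltn_trans; rewrite mdegE (bigD1 i) //= leq_addr.
have := congr1 (fun Q : {poly F} => Q`_(K x)) P0.
rewrite /P coef_sum coef0 (bigD1_seq x) //= big_seq_cond big1 => [|y /andP[yp yx]].
  rewrite addr0 coefZ coefXn eqxx mulr1 => /eqP; rewrite intr_eq0 => /eqP.
  by move/eqP; rewrite mcoeff_eq0 xp.
rewrite coefZ coefXn; have [E|_] := eqVneq (K x) (K y); last by rewrite mulr0.
case/eqP: yx; apply/mnmP => i; apply/esym.
by apply: (digits_inj (fun i => ltD x i xp) (fun i => ltD y i yp)).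
Qed.

Lemma rmorph_mpoly_id (f : {rmorphism Pol -> Pol}) :
  (forall i, f 'X_i = 'X_i) -> forall p, f p = p.
Proof.
move=> fX p; rewrite [in LHS](mpolyE p) rmorph_sum [RHS]mpolyE; apply: eq_bigr => m _.
rewrite -mul_mpolyC /= -[p@_m]intz rmorphM !rmorph_int; congr (_ * _).
rewrite mpolyXE_id rmorph_prod; apply: eq_bigr => i _.
by rewrite rmorphXn fX.
Qed.

(** * Polynomials in z and the final division *)

Definition z_index : 'I_5 := @Ordinal 5 3 isT.

(** The coefficients stay in [Pol], so that evaluation at [vz] recovers the polynomial. *)
Definition as_poly_z : {rmorphism Pol -> {poly Pol}} :=
  mmap (intmul 1) (fun i : 'I_5 => if i == z_index then 'X else ('X_i)%:P).

Lemma as_poly_zX i : as_poly_z 'X_i = if i == z_index then 'X else ('X_i)%:P.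
Proof. by rewrite /= mmapX mmap1U. Qed.

Lemma as_poly_zK p : (as_poly_z p).[vz] = p.
Proof.
apply: (@rmorph_mpoly_id (horner_eval vz \o as_poly_z)) => i.
rewrite /= -[mmap _ _ _]/(as_poly_z _) as_poly_zX /horner_eval.
by case: eqP => [->|_]; rewrite ?hornerX ?hornerC.
Qed.

(** The value of d at [rho = k + 2 > 1], which gives infinitely many rational specialisations. *)
Definition loop_value (k : nat) : rat := (k.+2%:R ^+ 4) + (k.+2%:R ^+ 4)^-1.

Lemma loop_value_inj : injective loop_value.
Proof.
move=> i j; rewrite /loop_value.
have gt1 k : 1 < k.+2%:R :> rat by rewrite ltr1n.
have := gt1 i; have := gt1 j; have inj : i.+2%:R = j.+2%:R :> rat -> i = j.
  by move/eqP; rewrite eqr_nat => /eqP [].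
move: inj; move: (i.+2%:R) (j.+2%:R) => x y inj y1 x1 E; apply: inj.
have x0 : 0 < x by apply: lt_trans x1.
have y0 : 0 < y by apply: lt_trans y1.
have X1 : 1 < x ^+ 4 by rewrite exprn_egt1.
have Y1 : 1 < y ^+ 4 by rewrite exprn_egt1.
have : (x ^+ 4 - y ^+ 4) * (x ^+ 4 * y ^+ 4 - 1) = 0.
  have -> : (x ^+ 4 - y ^+ 4) * (x ^+ 4 * y ^+ 4 - 1) =
     (x ^+ 4 + (x ^+ 4)^-1 - (y ^+ 4 + (y ^+ 4)^-1)) * (x ^+ 4 * y ^+ 4).
    by field; rewrite !gt_eqF.
  by rewrite E subrr mul0r.
move/eqP; rewrite mulf_eq0 !subr_eq0 => /orP[|].
  by rewrite eqrXn2 ?ltW // => /eqP.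
by rewrite gt_eqF // mulr_egt1.
Qed.

Theorem mainTheorem1 (n : nat) : (1 <= n)%N ->
  exists q : {mpoly int[5]},
    GramDet n =
    (\prod_(1 <= k < n.+1) (chebT vd k + (-1) ^+ k * vz) ^+ 'C(n.*2, n - k)) * q.
Proof.
move=> _.
pose fac k : Pol := chebT vd k + (-1) ^+ k * vz.
(* Made monic in z, the divisor changes only by the sign [s], whose square is 1. *)
pose P : {poly Pol} := \prod_(1 <= k < n.+1)
  ('X - (- ((-1) ^+ k * chebT vd k))%:P) ^+ 'C(n.*2, n - k).
pose s : {poly Pol} := \prod_(1 <= k < n.+1) ((-1) ^+ k) ^+ 'C(n.*2, n - k).
have tvd : as_poly_z vd = vd%:P by rewrite as_poly_zX.
have tvz : as_poly_z vz = 'X by rewrite as_poly_zX.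
have sgn k : (-1) ^+ k * (-1) ^+ k = 1 :> {poly Pol} by rewrite -exprMn mulrNN mulr1 expr1n.
have facE k : as_poly_z (fac k) = (-1) ^+ k * ('X - (- ((-1) ^+ k * chebT vd k))%:P).
  rewrite /fac rmorphD rmorphM rmorphXn rmorphN1 tvz chebT_morph tvd -chebT_morph.
  by rewrite polyCN opprK polyCM polyC_exp polyCN mulrDr mulrA sgn mul1r addrC.
have PE : P = s * as_poly_z (\prod_(1 <= k < n.+1) fac k ^+ 'C(n.*2, n - k)).
  rewrite rmorph_prod -big_split; apply: eq_bigr => k _ /=.
  by rewrite rmorphXn facE -exprMn mulrA sgn mul1r.
have Pmonic : P \is monic by apply: monic_prod => k _; apply/monic_exp/monicXsubC.
pose Q := Pdiv.Ring.rdivp (as_poly_z (GramDet n)) P.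
pose R := Pdiv.Ring.rmodp (as_poly_z (GramDet n)) P.
have DE : as_poly_z (GramDet n) = Q * P + R by apply: Pdiv.RingMonic.rdivp_eq.
suff R0 : R = 0.
  exists ((Q * s).[vz]); rewrite -[LHS]as_poly_zK DE R0 addr0 PE mulrA hornerM as_poly_zK.
  by rewrite mulrC.
have ltR : (size R < size P)%N by apply: Pdiv.Ring.ltn_rmodpN0; apply: monic_neq0.
apply/polyP => i; rewrite coef0; apply: (mpoly_int_eq0 loop_value_inj) => k D.
(* The variable d has index 0 and [D ^ 0 = 1], so the Kronecker point gives d exactly
   [loop_value k]. *)
pose v (i : 'I_5) : rat := loop_value k ^+ (D ^ i).
pose ev : {rmorphism Pol -> rat} := mmap (intmul 1) v.
rewrite -[mmap _ _ _]/(ev R`_i) -coef_map.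
suff -> : map_poly ev R = 0 by rewrite coef0.
pose phi : {rmorphism Pol -> {poly rat}} := map_poly ev \o as_poly_z.
have phid : phi vd = (loop_value k)%:P.
  by rewrite /= -[mmap _ _ vd]/(as_poly_z vd) tvd map_polyC /= mmapX mmap1U.
have phiz : phi vz = 'X.
  by rewrite /= -[mmap _ _ vz]/(as_poly_z vz) tvz map_polyX.
have k1 : 1 < k.+2%:R :> rat by rewrite ltr1n.
have ss : s * s = 1.
  rewrite /s -big_split big1 // => j _ /=.
  by rewrite -exprMn sgn expr1n.
have dvP : map_poly ev P %| map_poly ev R.
  have dvD : map_poly ev P %| phi (GramDet n).
    apply: dvdp_trans (@phi_Gram_dvd _ n _ phi k1 phid phiz).
    under eq_bigr => j _ do rewrite -rmorphXn.
    rewrite -rmorph_prod -[X in _ %| X]/(map_poly ev (as_poly_z _)).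
    rewrite -[as_poly_z _]mul1r -ss -mulrA -PE rmorphM /=.
    exact: dvdp_mull.
  have : phi (GramDet n) = map_poly ev Q * map_poly ev P + map_poly ev R.
    by rewrite -rmorphM -rmorphD -DE.
  by move=> E; rewrite E dvdp_addr ?dvdp_mull in dvD.
(* Being monic, [P] keeps its degree under specialisation, so a nonzero image of [R] would be too
   small to be a multiple. *)
apply/eqP/negPn/negP => R0; have := dvdp_leq R0 dvP.
rewrite (size_map_poly_id0 (p := P)); last by rewrite (monicP Pmonic) rmorph1 oner_eq0.
by rewrite leqNgt (leq_ltn_trans (size_poly _ _) ltR).
Qed.
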